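(* There exist constants $\varepsilon > 0$ and $C > 1$ and an integer $n_0$ such that for every odd $n \ge n_0$ the following holds. Let $G$ be a graph on $n$ vertices satisfying the following three conditions for some $p \geq C \log n / n$: (i) $\delta(G)\geq (1-\varepsilon)np$; (ii) $G$ is $(p,\beta)$-jumbled for some $\beta\leq \varepsilon np / \log\log n$; (iii) there exists an edge of $G$ between every two disjoint subsets of vertices $A, B \subseteq V(G)$ such that $|A|, |B| \ge \varepsilon n \frac{\log\log n}{\log n}$. Then $\mathcal{C}_n(G) = \mathcal{C}(G)$.
   Context: Graphs are finite and simple; $\log$ is the natural logarithm; $\delta(G)$ is the minimum degree. A graph $G$ is $(p,\beta)$-jumbled, where $0 < p < 1 \leq \beta$, if for every $U \subseteq V(G)$ we have $\left| e_G(U) - p\binom{|U|}{2} \right| \leq \beta |U|$, where $e_G(U)$ is the number of edges of $G$ with both endpoints in $U$. For a graph $G=(V,E)$, the edge space $\mathcal{E}(G)$ is the $\mathbb{F}_2$-vector space of all subsets of $E$, with addition given by symmetric difference. The cycle space $\mathcal{C}(G) \subseteq \mathcal{E}(G)$ is the subspace spanned by (the edge sets of) all, not necessarily induced, cycles in $G$. For an integer $k$, $\mathcal{C}_k(G) \subseteq \mathcal{C}(G)$ is the subspace spanned by the edge sets of all cycles in $G$ of length exactly $k$. Thus, if $G$ has $n$ vertices, $\mathcal{C}_n(G)$ is the subspace spanned by the Hamilton cycles of $G$. *)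

(* Defs.v *)
From HB Require Import structures.
From mathcomp Require Import all_boot all_order all_algebra.
From mathcomp Require Import all_classical all_reals all_analysis.
Set Implicit Arguments.
Unset Strict Implicit.
Unset Printing Implicit Defensive.
Import Order.TTheory GRing.Theory Num.Theory.
Local Open Scope ring_scope.

(* A finite simple graph on the vertex type T is given by its adjacency
   relation e, assumed symmetric and irreflexive where it is used. *)
Definition edge_set (T : finType) (e : rel T) : {set {set T}} :=
  [set f : {set T} | [exists x, [exists y, e x y && (f == [set x; y])]]].

Definition edges_in (T : finType) (e : rel T) (U : {set T}) : nat :=
  #|[set f in edge_set e | f \subset U]|.

Definition degree (T : finType) (e : rel T) (x : T) : nat :=
  #|[set y | e x y]|.

(* Every degree is at most #|T|, so the default value #|T| does not affect the
   minimum unless T is empty. *)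
Definition min_degree (T : finType) (e : rel T) : nat :=
  \big[minn/#|T|]_(x : T) degree e x.

Definition jumbled (R : realType) (T : finType) (e : rel T) (p beta : R) :
    Prop :=
  [/\ 0 < p, p < 1, 1 <= beta
    & forall U : {set T},
        `|(edges_in e U)%:R - p * 'C(#|U|, 2)%:R| <= beta * #|U|%:R].

Definition edge_type (T : finType) (e : rel T) : finType :=
  {f : {set T} | f \in edge_set e}.

(* A set of edges is identified with its indicator vector over 'F_2, which
   turns symmetric difference into addition. *)
Definition edge_space (T : finType) (e : rel T) : vectType 'F_2 :=
  {ffun edge_type e -> ('F_2)^o}.

Definition edge_vector (T : finType) (e : rel T) (F : {set {set T}}) :
    edge_space e :=
  [ffun f : edge_type e => (val f \in F)%:R].

Definition cycle_edges (T : finType) (c : seq T) : {set {set T}} :=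
  [set [set x; next c x] | x in c].

(* Without the bound 2 < k, ucycle would accept a single edge as a cycle of
   length two, and the empty sequence. *)
Definition cycles (T : finType) (e : rel T) (k : nat) : {set {set {set T}}} :=
  [set cycle_edges c | c : k.-tuple T & (2 < k)%N && ucycleb e c].

Definition all_cycles (T : finType) (e : rel T) : {set {set {set T}}} :=
  \bigcup_(k < #|T|.+1) cycles e k.

Definition edge_span (T : finType) (e : rel T) (S : {set {set {set T}}}) :
    {vspace edge_space e} :=
  <<[seq edge_vector e F | F <- enum S]>>%VS.

Definition cycle_space (T : finType) (e : rel T) : {vspace edge_space e} :=
  edge_span e (all_cycles e).

Definition cycle_space_k (T : finType) (e : rel T) (k : nat) :
    {vspace edge_space e} :=
  edge_span e (cycles e k).

(* Main.v *)
(* A labelling r of the edges by bits that is even on all Hamilton cycles has to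
   be a cut; over F_2 this dualises to the equality of the two spaces.  Split V at
   random into L and R, so that every vertex keeps a constant fraction of its
   degree on either side.  All sets obtained from L or R by moving boundedly many
   vertices are then Hamilton-connected.  Joining a Hamilton path l -> x of L to a
   Hamilton path l' -> y of R by two edges ll' and xy gives Hamilton cycles, whose
   parity shows r xy + r ll' = F(l, x) + G(l', y): on the edges between L and R,
   r is a cut.  Moving one or two vertices across shows that r is, up to a cut, a
   constant c on the edges inside L and R.  Once l and l' are put back, comparing
   Hamilton cycles that use different edges at l and l' gives c = 0, where n odd
   is needed.

   Hamilton-connectedness follows Hefetz, Krivelevich and Szabo: a longest path,
   with a virtual edge ab that is never removed, gives quadratically many pairs of
   ends after O(log n) rotations each.  Cut it into about log n segments; by double
   counting, many of the resulting paths run first through one fixed family of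
   loglog n segments and then through another one, all of them intact.  From then
   on the two ends rotate independently inside the two families, up to sets of
   ends so large that an edge joins them. *)
Require Import Defs.
From HB Require Import structures.
From mathcomp Require Import all_boot all_order all_algebra.
From mathcomp Require Import all_classical all_reals all_analysis.
From mathcomp Require Import fintype finset zify ring lra.
Set Implicit Arguments.
Unset Strict Implicit.
Unset Printing Implicit Defensive.
Import Order.TTheory GRing.Theory Num.Theory.
Local Open Scope ring_scope.

(** * Adjacency along a sequence *)

(** After the usual rotations quadratically many pairs of vertices are ends of longest paths, but a
    sparse graph may miss all of these pairs, and [joined] provides edges only between the two sides
    of a product A × B. The two families of segments produce such a product, since rotations inside
    one family do not disturb the other. Their sizes are tied to the hypotheses. O(log n) rotations
    spoil O(log n) segments, so among a larger multiple of log n segments a constant proportion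
    stays intact. The j segments of a family must hold about 13 m vertices, where m, close to ε n
    loglog n / log n, is the size from which sets are joined; this asks for j of order loglog n.
    Averaging over pairs of families costs a factor 64^j, a small power of log n, which is
    affordable because m is smaller than n by almost a factor log n. *)

Section SequenceAdjacency.
Local Open Scope nat_scope.
Variable T : eqType.
Implicit Types (s : seq T) (u v w x y : T).

(** Undirected on purpose: the relation is invariant under reversal, so the edges of a path and of
    its rotations can be compared regardless of the direction of traversal. *)
Fixpoint adj s u v : bool :=
  if s is x :: s' then
    (if s' is y :: _ then
       [|| (x == u) && (y == v), (x == v) && (y == u) | adj s' u v]
     else false)
  else false.

Lemma adj_cons2 x y s u v :
  adj (x :: y :: s) u v =
  [|| (x == u) && (y == v), (x == v) && (y == u) | adj (y :: s) u v].
Proof. by []. Qed.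

Lemma adjC s u v : adj s u v = adj s v u.
Proof.
elim: s => [|x [|y s] IH] //.
by rewrite !adj_cons2 IH orbCA.
Qed.

Lemma adj_cat s1 w y s2 u v :
  adj (rcons s1 w ++ y :: s2) u v =
  [|| adj (rcons s1 w) u v, (w == u) && (y == v), (w == v) && (y == u)
    | adj (y :: s2) u v].
Proof.
elim: s1 => [|x [|z s1] IH] //.
  by rewrite /= !orbF !orbA.
by rewrite !rcons_cons !cat_cons !adj_cons2 -rcons_cons -cat_cons IH -!orbA.
Qed.

Lemma adj_rcons2 s x y u v :
  adj (rcons (rcons s x) y) u v =
  [|| adj (rcons s x) u v, (x == u) && (y == v) | (x == v) && (y == u)].
Proof. by rewrite -[rcons (rcons s x) y]cats1 adj_cat /= orbF. Qed.

Lemma adj_rev s u v : adj (rev s) u v = adj s u v.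
Proof.
elim: s => [|x [|y s] IH] //.
rewrite rev_cons rev_cons adj_rcons2 -rev_cons IH adj_cons2 [RHS]orbA [RHS]orbC.
by congr (_ || _); rewrite orbC andbC [X in _ || X]andbC.
Qed.

Lemma adj_mem s u v : adj s u v -> (u \in s) && (v \in s).
Proof.
elim: s => [|x [|y s] IH] //; rewrite adj_cons2.
case/or3P=> [/andP[/eqP-> /eqP->]|/andP[/eqP-> /eqP->]|/IH/andP[us vs]].
- by rewrite !inE !eqxx !orbT.
- by rewrite !inE !eqxx !orbT.
- by rewrite [u \in _]in_cons [v \in _]in_cons us vs !orbT.
Qed.

Lemma adj_meml s u v : adj s u v -> u \in s.
Proof. by case/adj_mem/andP. Qed.

Lemma adj_memr s u v : adj s u v -> v \in s.
Proof. by case/adj_mem/andP. Qed.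

Lemma adj_index s u v : uniq s ->
  adj s u v ->
  (index v s == (index u s).+1) || (index u s == (index v s).+1).
Proof.
elim: s => [|x [|y s] IH] // /andP[xs us]; rewrite adj_cons2.
case/or3P=> [/andP[/eqP<- /eqP<-]|/andP[/eqP<- /eqP<-]|/[dup] /adj_mem/andP[uy vy] auv].
- move: xs; rewrite !inE negb_or => /andP[xy _].
  by rewrite /= !eqxx (negbTE xy).
- move: xs; rewrite !inE negb_or => /andP[xy _].
  by rewrite /= !eqxx (negbTE xy) orbT.
have xu : x != u by apply: contraNneq xs => ->.
have xv : x != v by apply: contraNneq xs => ->.
by move: (IH us auv); rewrite ![index _ (x :: _)]/= (negbTE xu) (negbTE xv) !eqSS.
Qed.

Lemma adj_nth x0 s i : i.+1 < size s -> adj s (nth x0 s i) (nth x0 s i.+1).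
Proof.
elim: s i => [|x [|y s] IH] // [|i] Hi; first by rewrite /= !eqxx.
by rewrite adj_cons2 [nth _ _ _]/= (IH i) ?orbT.
Qed.

Lemma sorted_adjP (r : rel T) s : symmetric r ->
  reflect (forall u v, adj s u v -> r u v) (sorted r s).
Proof.
move=> rC; apply: (iffP idP) => [|H].
  elim: s => [|x [|y s] IH] // /= /andP[rxy pys] u v.
  case/or3P=> [/andP[/eqP<- /eqP<-]|/andP[/eqP<- /eqP<-]|]; rewrite // ?(rC y) //.
  exact: IH.
elim: s H => [|x [|y s] IH] // H /=; rewrite H ?adj_cons2 ?eqxx //=.
by apply: IH => u v auv; apply: H; rewrite adj_cons2 auv !orbT.
Qed.

Lemma split_in s x y : y \in x :: s -> y != x ->
  exists s1 w s2, x :: s = rcons s1 w ++ y :: s2.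
Proof.
rewrite inE => /orP[/eqP->|ys _]; first by rewrite eqxx.
case/splitPr: ys => p1 p2; exists (belast x p1), (last x p1), p2.
by rewrite -lastI.
Qed.

End SequenceAdjacency.

Lemma card_adj_le2 (T : finType) (s : seq T) (y : T) : uniq s ->
  (#|[set w | adj s w y]| <= 2)%N.
Proof.
move=> us.
apply: (@leq_trans #|[set nth y s (index y s).+1; nth y s (index y s).-1]|).
  apply/subset_leq_card/subsetP => w; rewrite inE => a.
  have ws := adj_meml a; rewrite !inE.
  case/orP: (adj_index us a) => /eqP E.
    by rewrite E /= nth_index // eqxx orbT.
  by rewrite -E nth_index // eqxx.
by rewrite cards2; case: (_ != _).
Qed.

(** * Rotations *)

Section Rotations.
Local Open Scope nat_scope.
Variables (T : finType) (e : rel T) (a b : T).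
Hypotheses (e_sym : symmetric e) (e_irr : irreflexive e).
Implicit Types (s p : seq T) (u v w x y : T) (Z : {set T}).

Definition forced u v := ((u == a) && (v == b)) || ((u == b) && (v == a)).

Definition eplus u v := e u v || forced u v.

Lemma forcedC : symmetric forced.
Proof. by move=> u v; rewrite /forced orbC andbC [X in _ || X]andbC. Qed.

Lemma eplus_sym : symmetric eplus.
Proof. by move=> u v; rewrite /eplus e_sym forcedC. Qed.

(* Posa rotations at the head of a path which never remove the edge ab;
   [Z] collects all heads met so far. *)
Inductive rots (s0 : seq T) : nat -> {set T} -> seq T -> Prop :=
| Rots_start x p : s0 = x :: p -> rots s0 0 [set x] (x :: p)
| Rots_idle t Z s : rots s0 t Z s -> rots s0 t.+1 Z s
| Rots_step t Z x p s1 w y s2 :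
    rots s0 t Z (x :: p) -> x :: p = rcons s1 w ++ y :: s2 -> e x y ->
    ~~ forced w y -> rots s0 t.+1 (w |: Z) (w :: rev s1 ++ y :: s2).

(** Through [Rots_idle], [t] is only an upper bound on the number of rotations, so these sets
    increase with [t]. *)
Definition ends (s0 : seq T) (t : nat) : {set T} :=
  [set x | `[< exists Z p, rots s0 t Z (x :: p) >]].

Lemma endsP s0 t x : reflect (exists Z p, rots s0 t Z (x :: p)) (x \in ends s0 t).
Proof. by rewrite inE; exact: asboolP. Qed.

Lemma rotation_rev x p s1 w y s2 : x :: p = rcons s1 w ++ y :: s2 ->
  exists q, rcons s1 w = x :: q /\ w :: rev s1 ++ y :: s2 = rcons (rev q) x ++ y :: s2.
Proof.
case: s1 => [|z s1] /= [-> _]; first by exists [::].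
exists (rcons s1 w); split=> //.
by rewrite rev_rcons rev_cons.
Qed.

Lemma rotation_adj x p s1 w y s2 u v : x :: p = rcons s1 w ++ y :: s2 ->
  adj (w :: rev s1 ++ y :: s2) u v =
  [|| adj (rcons s1 w) u v, (x == u) && (y == v), (x == v) && (y == u)
    | adj (y :: s2) u v].
Proof.
move=> /rotation_rev[q [E ->]].
by rewrite adj_cat -rev_cons adj_rev E.
Qed.

Lemma rots_perm s0 t Z s : rots s0 t Z s -> perm_eq s s0.
Proof.
elim=> {t Z s} [x p ->|//|t Z x p s1 w y s2 _ IH E _ _] //.
rewrite -(permPr IH) E -cat_cons perm_cat2r -rev_rcons perm_rev //.
Qed.

Lemma rots_last s0 t Z s d : rots s0 t Z s -> last d s = last d s0.
Proof.
elim=> {t Z s} [x p ->|//|t Z x p s1 w y s2 _ <- E _ _] //.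
by rewrite E -cat_cons !last_cat.
Qed.

Lemma rots_sorted s0 t Z s : rots s0 t Z s -> sorted eplus s0 -> sorted eplus s.
Proof.
elim=> {t Z s} [x p ->|//|t Z x p s1 w y s2 _ IH E exy _ /IH] //.
move=> /(sorted_adjP _ eplus_sym) H; apply/(sorted_adjP _ eplus_sym) => u v.
rewrite (rotation_adj _ _ E) => /or4P[A|/andP[/eqP<- /eqP<-]|/andP[/eqP<- /eqP<-]|A].
- by apply: H; rewrite E adj_cat A.
- by rewrite /eplus exy.
- by rewrite /eplus e_sym exy.
- by apply: H; rewrite E adj_cat A !orbT.
Qed.

Lemma rots_adj_forced s0 t Z s : rots s0 t Z s -> adj s0 a b -> adj s a b.
Proof.
elim=> {t Z s} [x p ->|//|t Z x p s1 w y s2 _ IH E exy nf /IH] //.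
rewrite (rotation_adj _ _ E) E adj_cat.
case/or4P=> [->|/andP[/eqP wa /eqP yb]|/andP[/eqP wb /eqP ya]|->]; rewrite ?orbT //.
  by move: nf; rewrite /forced wa yb !eqxx.
by move: nf; rewrite /forced wb ya !eqxx orbT.
Qed.

Lemma rots_head s0 t Z s : rots s0 t Z s -> forall x p, s = x :: p -> x \in Z.
Proof.
elim=> {t Z s} [x p _ y q [<- _]|//|t Z x p s1 w y s2 _ _ _ _ _ z q [<- _]].
  by rewrite inE.
by rewrite !inE eqxx.
Qed.

Lemma rots_card s0 t Z s : rots s0 t Z s -> #|Z| <= t.+1.
Proof.
elim=> {t Z s} [x p _|t Z s _ /leqW|t Z x p s1 w y s2 _ IH _ _ _] //.
  by rewrite cards1.
by rewrite cardsU1 -addn1 addnC leq_add // leq_b1.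
Qed.

Lemma ends_idle s0 t : ends s0 t \subset ends s0 t.+1.
Proof.
apply/subsetP => x /endsP[Z [p R]]; apply/endsP; exists Z, p; exact: Rots_idle.
Qed.

Lemma ends_mono s0 t t' : t <= t' -> ends s0 t \subset ends s0 t'.
Proof.
elim: t' => [|t' IH]; first by rewrite leqn0 => /eqP->.
rewrite leq_eqVlt => /orP[/eqP->//|/IH H].
exact: subset_trans H (ends_idle _ _).
Qed.

Lemma rots_sub_ends s0 t Z s : rots s0 t Z s -> Z \subset ends s0 t.
Proof.
elim=> {t Z s} [x p E|t Z s _ H|t Z x p s1 w y s2 R H E exy nf].
- by apply/subsetP => y /set1P->; apply/endsP; exists [set x], p; apply: Rots_start.
- exact: subset_trans H (ends_idle _ _).
rewrite subUset sub1set (subset_trans H (ends_idle _ _)) andbT.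
by apply/endsP; do 2!eexists; apply: (Rots_step R E exy nf).
Qed.

Lemma ends_mem s0 t x : x \in ends s0 t -> x \in s0.
Proof.
by case/endsP=> Z [p /rots_perm/perm_mem <-]; rewrite inE eqxx.
Qed.

Lemma ends0 x p : x \in ends (x :: p) 0.
Proof. by apply/endsP; exists [set x], p; apply: Rots_start. Qed.

(* An edge is removed or created only at a vertex which is a head at that time. *)
Lemma rots_intact s0 t Z s : rots s0 t Z s -> forall y, y \notin Z ->
  (forall w, adj s0 w y -> w \notin Z) -> forall w, adj s w y = adj s0 w y.
Proof.
elim=> {t Z s} [x p ->|//|t Z x p s1 w0 y0 s2 R IH E _ _] // y.
rewrite !inE negb_or => /andP[yw0 yZ] nb w.
have yx : x == y = false.
  by apply/eqP => xy; move: yZ; rewrite -xy (rots_head R (erefl _)).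
have {}IH : forall w, adj (x :: p) w y = adj s0 w y.
  by apply: IH => // z /nb; rewrite !inE negb_or => /andP[].
have yy0 : y0 == y = false.
  apply/eqP => Ey.
  have : adj s0 w0 y by rewrite -IH E adj_cat Ey !eqxx orbT.
  by move/nb; rewrite !inE eqxx.
rewrite -IH E (rotation_adj _ _ E) adj_cat yx yy0 eq_sym in yw0 *.
by rewrite (negbTE yw0) !andbF.
Qed.

(** If neither y nor a path neighbour of y has been a head, both edges at y are still those of [s0],
    and rotating at y makes one of these neighbours the head. As y is neither a nor b, the removed
    edge is not ab. *)
Lemma posa s0 t x y : x \in ends s0 t -> e x y -> y \in s0 -> y != a -> y != b ->
  y \in ends s0 t \/ exists2 w, adj s0 w y & w \in ends s0 t.+1.
Proof.
move=> /endsP[Z [p R]] exy ys ya yb.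
have sZ := subsetP (rots_sub_ends R).
have [/sZ|yZ] := boolP (y \in Z); first by left.
right; have [[w ay wZ]|nb] := pselect (exists2 w, adj s0 w y & w \in Z).
  by exists w => //; apply: (subsetP (ends_idle _ _)); apply: sZ.
have I : forall w, adj (x :: p) w y = adj s0 w y.
  by apply: (rots_intact R) => // w ay; apply/negP => wZ; apply: nb; exists w.
have yp : y \in x :: p by rewrite (perm_mem (rots_perm R)).
have yx : y != x by apply: contraTneq exy => ->; rewrite e_irr.
have [s1 [w [s2 E]]] := split_in yp yx.
exists w; first by rewrite -I E adj_cat !eqxx orbT.
apply/endsP; do 2!eexists; apply: (Rots_step R E exy).
by rewrite /forced (negbTE ya) (negbTE yb) !andbF.
Qed.

End Rotations.

Lemma card_bigcup_le (I T : finType) (S : {set I}) (F : I -> {set T}) (k : nat) :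
  (forall i, i \in S -> #|F i| <= k)%N -> (#|\bigcup_(i in S) F i| <= k * #|S|)%N.
Proof.
move=> H; apply: (@leq_trans (\sum_(i in S) #|F i|)).
  elim/big_rec2: _ => [|i n A _ IH]; first by rewrite cards0.
  by rewrite cardsU; lia.
by rewrite mulnC -sum_nat_const; apply: leq_sum.
Qed.

(** * Growth of the set of heads *)

Section Growth.
Local Open Scope nat_scope.
Variables (T : finType) (e : rel T).
Hypotheses (e_sym : symmetric e) (e_irr : irreflexive e).
Variable m : nat.

Definition nbh (S : {set T}) : {set T} :=
  [set y | (y \notin S) && [exists x in S, e x y]].

Definition expands := forall S : {set T}, 0 < #|S| <= m -> 10 * #|S| <= #|nbh S|.

Definition joined := forall A B : {set T}, [disjoint A & B] ->
  m <= #|A| -> m <= #|B| -> exists x y, [/\ x \in A, y \in B & e x y].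

Hypotheses (eE : expands) (eJ : joined).

(** No edge runs from S to the vertices outside S and its neighbourhood, so there are fewer than m
    of these. *)
Lemma joined_card (S : {set T}) : 0 < m <= #|S| -> #|T| < #|S| + #|nbh S| + m.
Proof.
case/andP=> m0 mS; rewrite ltnNge; apply/negP => H.
have E : #|S :|: nbh S| <= #|S| + #|nbh S| by rewrite cardsU leq_subr.
have D : [disjoint S & ~: (S :|: nbh S)].
  by rewrite disjoints_subset setCK finset.subsetUl.
have [] := eJ D mS; first by rewrite cardsCs setCK; lia.
move=> x [y [xS]]; rewrite !inE negb_or => /andP[yS]; rewrite yS /= => /negP nb exy.
by case: nb; apply/exists_inP; exists x.
Qed.

Variables a b : T.
Hypothesis ab : a != b.

Definition nbs (s : seq T) (S : {set T}) : {set T} :=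
  \bigcup_(w in S) [set y | adj s w y].

Lemma card_nbs s S : uniq s -> #|nbs s S| <= 2 * #|S|.
Proof.
move=> us; apply: card_bigcup_le => w _.
rewrite (_ : [set _ | _] = [set y | adj s y w]) ?card_adj_le2 //.
by apply/setP => y; rewrite !inE adjC.
Qed.

(** Every competitor has to use the virtual edge: a spanning cycle through ab, opened at ab, is a
    Hamilton path of the graph itself from a to b. *)
Definition hpath (s : seq T) := [&& uniq s, sorted (eplus e a b) s & adj s a b].

Definition maxpath s := hpath s /\ forall s', hpath s' -> size s' <= size s.

Lemma hpath_uniq s : hpath s -> uniq s. Proof. by case/and3P. Qed.

Lemma rots_maxpath s0 t Z s : maxpath s0 -> rots e a b s0 t Z s -> maxpath s.
Proof.
move=> [/and3P[u so ad] M] R.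
have P := rots_perm R; split.
  rewrite /hpath (perm_uniq P) u (rots_sorted e_sym R so) /=.
  exact: (rots_adj_forced R).
by move=> s' /M; rewrite (perm_size P).
Qed.

Lemma hpath_rev s : hpath (rev s) = hpath s.
Proof.
rewrite /hpath rev_uniq adj_rev; congr [&& _, _ & _].
by apply/(sorted_adjP _ (eplus_sym a b e_sym))/(sorted_adjP _ (eplus_sym a b e_sym)) => H u v;
  move: (H u v); rewrite adj_rev.
Qed.

Lemma maxpath_rev s : maxpath s -> maxpath (rev s).
Proof. by case=> h M; split; rewrite ?hpath_rev // => s' /M; rewrite size_rev. Qed.

Lemma maxpath_nbr x p y : maxpath (x :: p) -> e x y -> y \in x :: p.
Proof.
move=> [/and3P[u so ad] M] exy; apply: contraT => yxp.
have : hpath (y :: x :: p).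
  rewrite /hpath cons_uniq yxp u /= /eplus e_sym exy /=.
  by move: so ad; rewrite /= => -> ->; rewrite !orbT.
by move/M; rewrite /= ltnn.
Qed.

(** By maximality all neighbours of a head lie on the path, and [posa] applies to those other than a
    and b. *)
Lemma ends_nbh s0 t : maxpath s0 ->
  nbh (ends e a b s0 t) \subset [set a; b] :|: nbs s0 (ends e a b s0 t.+1).
Proof.
move=> M; apply/subsetP => y; rewrite inE => /andP[yS /exists_inP[x xS exy]].
rewrite !inE; have [//|ya] := eqVneq y a; have [//|yb] := eqVneq y b.
have ys : y \in s0.
  case/endsP: (xS) => Z [p R].
  rewrite -(perm_mem (rots_perm R)).
  exact: maxpath_nbr (rots_maxpath M R) exy.
have [|[w ay wS]] := posa e_irr xS exy ys ya yb; first by rewrite (negbTE yS).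
by apply/bigcupP; exists w; rewrite // inE adjC adjC.
Qed.

Lemma ends_nbh_card s0 t : maxpath s0 ->
  #|nbh (ends e a b s0 t)| <= 2 * #|ends e a b s0 t.+1| + 2.
Proof.
move=> M; apply: leq_trans (subset_leq_card (ends_nbh t M)) _.
rewrite cardsU (leq_trans (leq_subr _ _)) // addnC.
by rewrite leq_add ?card_nbs ?cards2 ?ab //; case: M => /hpath_uniq.
Qed.

Lemma maxpath_cons s : maxpath s -> exists x p, s = x :: p.
Proof. by case: s => [[/and3P[]]|x p _] //; exists x, p. Qed.

(** A set S of at most m heads has at least 10 |S| outer neighbours, so the next set S' satisfies 2
    |S'| + 2 >= 10 |S|, whence |S'| >= 2 |S|. *)
Lemma ends_double s0 t : maxpath s0 ->
  m <= #|ends e a b s0 t| \/ 2 ^ t <= #|ends e a b s0 t|.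
Proof.
move=> M; elim: t => [|t IH].
  right; have [x [p E]] := maxpath_cons M.
  by rewrite E card_gt0; apply/set0Pn; exists x; exact: ends0.
have mono := subset_leq_card (ends_idle e a b s0 t).
case: IH => [H|H]; first by left; apply: leq_trans mono.
have [/leq_trans/(_ mono)|lt] := leqP m #|ends e a b s0 t|; first by left.
right; have p0 : 0 < #|ends e a b s0 t| by apply: leq_trans H; rewrite expn_gt0.
have := eE (S := ends e a b s0 t); rewrite p0 (ltnW lt) => /(_ isT).
have := ends_nbh_card t M; rewrite expnS; lia.
Qed.

(** Once m heads are reached, [joined_card] makes their neighbourhood cover almost everything, and
    one more rotation turns it into at least a quarter of all vertices. *)
Lemma ends_large s0 t : maxpath s0 -> 0 < m -> m <= 2 ^ t -> 4 * (m + 2) <= #|T| ->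
  #|T| <= 4 * #|ends e a b s0 t.+1|.
Proof.
move=> M m0 mt mT.
have mS : m <= #|ends e a b s0 t| by case: (ends_double t M) => //; apply: leq_trans.
have := @joined_card (ends e a b s0 t); rewrite m0 mS => /(_ isT).
have := ends_nbh_card t M.
have := subset_leq_card (ends_idle e a b s0 t); lia.
Qed.

End Growth.

(** * Expanding cores *)

Section Core.
Local Open Scope nat_scope.
Variables (T : finType) (e : rel T).
Hypotheses (e_sym : symmetric e) (e_irr : irreflexive e).
Variable m : nat.
Hypotheses (eJ : joined e m) (m0 : 0 < m).
Variable s0 : seq T.
Hypothesis us0 : uniq s0.

Definition nbrs (S : {set T}) : {set T} := [set y | [exists x in S, e x y]].

(* The interior of [D] with respect to the path [s0], not to the graph: rotating at
   a pivot in [inner D] yields a head in [D]. *)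
Definition inner (D : {set T}) : {set T} :=
  [set y in D | [set w | adj s0 w y] \subset D].

Lemma nbrsP (S : {set T}) y : reflect (exists2 x, x \in S & e x y) (y \in nbrs S).
Proof. by rewrite inE; apply: exists_inP. Qed.

Lemma innerS (A B : {set T}) : A \subset B -> inner A \subset inner B.
Proof.
move=> AB; apply/subsetP => y; rewrite !inE => /andP[/(subsetP AB)-> nA].
exact: subset_trans AB.
Qed.

Lemma inner_sub D : inner D \subset D.
Proof. by apply/subsetP => y; rewrite inE => /andP[]. Qed.

(** The factor 3 is chosen because S and its neighbours along [s0] have at most 3 |S| vertices
    together: the neighbours of S inside [inner D] cannot all be found there. *)
Definition core_expands (D : {set T}) := forall S : {set T},
  S \subset D -> 0 < #|S| <= m -> 3 * #|S| < #|nbrs S :&: inner D|.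

Lemma core_exists (C : {set T}) (bd : nat) :
  #|C :\: inner C| <= bd -> bd + 13 * m <= #|C| ->
  exists D : {set T}, [/\ D \subset C, 2 * m <= #|inner D|
    & core_expands D].
Proof.
move=> Cbd Cm.
pose P := fun X : {set T} => [&& X \subset C, #|X| <= 2 * m
                   & #|nbrs X :&: inner (C :\: X)| <= 3 * #|X|].
have P0 : P set0.
  rewrite /P finset.sub0set cards0 muln0 leqn0 cards_eq0 /=; apply/eqP/setP => y.
  by rewrite !inE; apply/negP => /andP[/exists_inP[x]]; rewrite inE.
(* A maximal badly expanding [X] cannot reach size [m], by [eJ]; after its removal
   a badly expanding set of size at most [m] could be added to it. *)
have [X /maxsetP[/and3P[XC X2 X3] Xmax] _] := maxset_exists P0.
(* Deleting X removes X itself and spoils at most 2 |X| path neighbours of X. *)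
have innerX : #|C| <= #|inner (C :\: X)| + bd + 3 * #|X|.
  have /subset_leq_card : C \subset
      inner (C :\: X) :|: (C :\: inner C) :|: (X :|: nbs s0 X).
    apply/subsetP => y yC; rewrite !inE yC !andbT.
    have [//|yX] := boolP (y \in X); first by rewrite !orbT.
    have [/bigcupP[w wX]|yn] := boolP (y \in nbs s0 X); first by rewrite !orbT.
    rewrite !orbF /=; have [nC|] := boolP (_ \subset C); last by rewrite orbT.
    rewrite orbF; apply/subsetP => w; rewrite !inE => aw.
    rewrite (subsetP nC) ?inE // andbT; apply: contra yn => wX.
    by apply/bigcupP; exists w; rewrite ?inE.
  have := card_nbs X us0.
  have := cardsU (inner (C :\: X) :|: (C :\: inner C)) (X :|: nbs s0 X).
  have := cardsU (inner (C :\: X)) (C :\: inner C).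
  have := cardsU X (nbs s0 X); lia.
(* Origin of the 13: if |X| >= m, then [inner (C :\: X)] has at most 3 |X| vertices adjacent to X
   and fewer than m others, so |C| < bd + 6 |X| + m <= bd + 13 m. *)
have Xm : #|X| < m.
  rewrite ltnNge; apply/negP => mX.
  have := joined_card eJ (S := X); rewrite m0 mX => /(_ isT) H.
  have /subset_leq_card : inner (C :\: X) \subset
      (nbrs X :&: inner (C :\: X)) :|: ~: (X :|: nbh e X).
    apply/subsetP => y yI; rewrite in_setU in_setI yI andbT !inE.
    have := subsetP (inner_sub _) _ yI.
    by rewrite !inE => /andP[/negbTE-> _]; case: [exists x in X, e x y].
  have := cardsU (nbrs X :&: inner (C :\: X)) (~: (X :|: nbh e X)).
  have := cardsC (X :|: nbh e X); have := cardsU X (nbh e X).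
  have -> : X :&: nbh e X = set0.
    by apply/setP => y; rewrite !inE; case: (y \in X).
  rewrite cards0; lia.
exists (C :\: X); split; [exact: finset.subsetDl|lia|move=> S SD /andP[S0 Sm]].
rewrite ltnNge; apply/negP => S3.
have XS : [disjoint X & S].
  by rewrite disjoint_sym; move: SD; rewrite subsetD => /andP[].
have XScard : #|X :|: S| = #|X| + #|S|.
  by rewrite cardsU (_ : X :&: S = set0) ?cards0 ?subn0 //; apply/eqP; rewrite setI_eq0.
have PXS : P (X :|: S).
  apply/and3P; split; [|lia|].
    by rewrite subUset XC (subset_trans SD) // finset.subsetDl.
  have /subset_leq_card : nbrs (X :|: S) :&: inner (C :\: (X :|: S)) \subset
      (nbrs X :&: inner (C :\: X)) :|: (nbrs S :&: inner (C :\: X)).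
    rewrite -finset.setIUl; apply: finset.setISS.
      apply/subsetP => y /nbrsP[x]; rewrite !inE => /orP[xX|xS] exy.
        by apply/orP; left; apply/exists_inP; exists x.
      by apply/orP; right; apply/exists_inP; exists x.
    by apply: innerS; apply: finset.setDS; apply: finset.subsetUl.
  move/leq_trans; apply.
  rewrite (leq_trans (leq_of_leqif (leq_card_setU _ _))) // XScard mulnDr; lia.
have E : X :|: S = X by apply: Xmax => //; apply: finset.subsetUl.
by move: XScard; rewrite E; lia.
Qed.

(** Otherwise m exceptional vertices and the rest of [inner D], still at least m vertices, would be
    joined. Hence almost every vertex can serve as the first head in [ends_core]. *)
Lemma few_bad (D : {set T}) : 2 * m <= #|inner D| ->
  #|[set v | ~~ [exists y in inner D, e v y]]| < m.
Proof.
move=> I2; set B := [set v | _]; rewrite ltnNge; apply/negP => mB.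
have [B' B'B cB'] : exists2 B' : {set T}, B' \subset B & #|B'| = m.
  have /card_gt0P[B'] : 0 < #|[set A : {set T} | A \subset B & #|A| == m]|.
    by rewrite cards_draws bin_gt0.
  by rewrite inE => /andP[H /eqP E]; exists B'.
have Dj : [disjoint B' & inner D :\: B'].
  by rewrite disjoint_sym disjoints_subset finset.setDE finset.subsetIr.
have [||x [y [xB]]] := eJ Dj; first by rewrite cB'.
  have := cardsD (inner D) B'; have := subset_leq_card (finset.subsetIr (inner D) B'); lia.
rewrite inE => /andP[_ yI] exy.
by have := subsetP B'B _ xB; rewrite inE => /negP; apply; apply/exists_inP; exists y.
Qed.

Variables a b : T.

Lemma ends_stable L : exists t, ends e a b L t.+1 = ends e a b L t.
Proof.
apply/not_existsP => H.
have : forall t, t <= #|ends e a b L t|.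
  elim=> [|t IH] //; apply: leq_ltn_trans IH _; apply: proper_card.
  by rewrite properEneq ends_idle andbT eq_sym; apply/eqP.
by move/(_ #|T|.+1); apply/negP; rewrite -ltnNge ltnS max_card.
Qed.

(** Take a saturated set A of heads. By [posa] every neighbour of A in [inner D] lies in A ∩ D or
    next to it along [s0], which allows at most 3 |A ∩ D| of them; if |A ∩ D| were at most m, this
    would contradict the expansion of D. *)
Lemma ends_core (D : {set T}) v L :
  core_expands D ->
  (exists2 y, y \in inner D & e v y) ->
  {subset D <= v :: L} -> a \notin D -> b \notin D ->
  (forall y w, y \in inner D -> adj (v :: L) w y = adj s0 w y) ->
  exists t, m <= #|ends e a b (v :: L) t|.
Proof.
move=> HD [y yI evy] sub aD bD intact.
have [t st] := ends_stable (v :: L); exists t.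
set A := ends e a b (v :: L) t in st *.
have key : forall x z, x \in A -> z \in inner D -> e x z ->
    z \in (A :&: D) :|: nbs s0 (A :&: D).
  move=> x z xA zI exz.
  have zD : z \in D by apply: (subsetP (inner_sub D)).
  have za : z != a by apply: contraNneq aD => <-.
  have zb : z != b by apply: contraNneq bD => <-.
  rewrite in_setU in_setI zD andbT.
  have [zA|[w ad]] := posa e_irr xA exz (sub _ zD) za zb; first by rewrite -/A in zA; rewrite zA.
  rewrite st => wA.
  have wad : adj s0 w z by rewrite -intact.
  apply/orP; right; apply/bigcupP; exists w; last by rewrite inE.
  rewrite in_setI wA /=.
  by move: zI; rewrite inE => /andP[_ /subsetP]; apply; rewrite inE.
have vA : v \in A by apply: (subsetP (ends_mono e a b (v :: L) (leq0n t))); apply: ends0.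
have S0 : 0 < #|A :&: D|.
  rewrite card_gt0; apply/set0Pn; have := key _ _ vA yI evy.
  rewrite in_setU => /orP[H|/bigcupP[w H _]]; first by exists y.
  by exists w.
suff : m < #|A :&: D|.
  by move=> H; apply: leq_trans (ltnW H) _; apply: subset_leq_card; apply: finset.subsetIl.
rewrite ltnNge; apply/negP => Sm.
have := HD (A :&: D) (finset.subsetIr _ _); rewrite S0 Sm => /(_ isT).
have /subset_leq_card : nbrs (A :&: D) :&: inner D \subset (A :&: D) :|: nbs s0 (A :&: D).
  apply/subsetP => z /setIP[/nbrsP[x /setIP[xA _] exz] zI]; exact: key exz.
have := card_nbs (A :&: D) us0.
have := cardsU (A :&: D) (nbs s0 (A :&: D)); lia.
Qed.

End Core.

(** * From a long cycle to a Hamilton path *)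

Section Closing.
Local Open Scope nat_scope.
Variables (T : finType) (e : rel T).
Hypotheses (e_sym : symmetric e) (e_irr : irreflexive e).
Variable m : nat.
Hypotheses (eE : expands e m) (eJ : joined e m) (m0 : 0 < m).
Variables a b : T.
Hypothesis ab : a != b.

Let eplus_adjP s := @sorted_adjP _ (eplus e a b) s (eplus_sym a b e_sym).

Lemma adj_split (s : seq T) x y : adj s x y ->
  exists s1 u v s2, s = rcons s1 u ++ v :: s2 /\
    ((u = x /\ v = y) \/ (u = y /\ v = x)).
Proof.
elim: s => [|z [|w s] IH] //; rewrite adj_cons2.
case/or3P=> [/andP[/eqP<- /eqP<-]|/andP[/eqP<- /eqP<-]|/IH].
- by exists [::], z, w, s; split=> //; left.
- by exists [::], z, w, s; split=> //; right.
by case=> s1 [u [v [s2 [-> H]]]]; exists (z :: s1), u, v, s2.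
Qed.

(** Each half is rotated at its outer end only, so its inner end u or w stays in place. The edge uw
    still links the halves, even if it is ab, and xy closes the cycle. *)
Lemma close_ends L u w R t t' x y : hpath e a b (rcons L u ++ w :: R) ->
  x \in ends e a b (rcons L u) t -> y \in ends e a b (rev (w :: R)) t' -> e x y ->
  exists z p, [/\ hpath e a b (z :: p), e (last z p) z
                & perm_eq (z :: p) (rcons L u ++ w :: R)].
Proof.
move=> /and3P[us /eplus_adjP ss sab] /endsP[Z [p1 R1]] /endsP[Z' [p2 R2]] exy.
have E1 : x :: p1 = rcons (belast x p1) u.
  by rewrite lastI; have := rots_last u R1; rewrite /= last_rcons => ->.
have E2 : rev (y :: p2) = w :: rev (belast y p2).
  rewrite lastI rev_rcons; have := rots_last w R2.
  by rewrite /= rev_cons last_rcons => ->.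
have P1 := rots_perm R1; have P2 := rots_perm R2.
have so1 : sorted (eplus e a b) (rcons L u).
  by apply/eplus_adjP => v v' H; apply: ss; rewrite adj_cat H.
have so2 : sorted (eplus e a b) (rev (w :: R)).
  by apply/eplus_adjP => v v'; rewrite adj_rev => H; apply: ss; rewrite adj_cat H !orbT.
have /eplus_adjP {}so1 := rots_sorted e_sym R1 so1.
have /eplus_adjP {}so2 := rots_sorted e_sym R2 so2.
have adjE v v' : adj ((x :: p1) ++ rev (y :: p2)) v v' =
    [|| adj (x :: p1) v v', (u == v) && (w == v'), (u == v') && (w == v)
      | adj (y :: p2) v v'].
  by rewrite E1 E2 adj_cat -E2 adj_rev.
have P : perm_eq ((x :: p1) ++ rev (y :: p2)) (rcons L u ++ w :: R).
  by apply: perm_cat => //; rewrite perm_rev (permPl P2) perm_rev.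
exists x, (p1 ++ rev (y :: p2)); split=> //.
- rewrite /hpath -cat_cons (perm_uniq P) us andTb.
  apply/andP; split.
    apply/eplus_adjP => v v'; rewrite adjE => /or4P[/so1//|H|H|/so2//]; apply: ss;
    by rewrite adj_cat H ?orbT.
  rewrite adjE; move: sab; rewrite adj_cat => /or4P[H|->|->|H]; rewrite ?orbT //.
    by rewrite (rots_adj_forced R1 H).
  by rewrite (rots_adj_forced R2) ?orbT // adj_rev.
- by rewrite rev_cons last_cat last_rcons e_sym.
Qed.

(** Either S or its complement has at most m vertices and expands, or both are large enough to be
    joined. *)
Lemma joined_connected (S : {set T}) : S != set0 -> S != setT ->
  exists x y, [/\ x \in S, y \notin S & e x y].
Proof.
wlog Sm : S / #|S| <= m => [H S0 ST|].
  have [Sm|mS] := leqP #|S| m; first exact: H.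
  have [Cm|mC] := leqP #|~: S| m.
    have [||x [y [xS yS exy]]] := H _ Cm.
    - by apply: contra ST => /eqP E; rewrite -(finset.setCK S) E finset.setC0.
    - by apply: contra S0 => /eqP E; rewrite -(finset.setCK S) E finset.setCT.
    by exists y, x; rewrite e_sym; move: xS yS; rewrite !inE negbK.
  have SC : [disjoint S & ~: S] by rewrite disjoints_subset finset.setCK.
  have [x [y [xS]]] := eJ SC (ltnW mS) (ltnW mC).
  by rewrite inE => yS exy; exists x, y.
rewrite -card_gt0 => S0 _.
have := eE (S := S); rewrite S0 Sm => /(_ isT) H.
have /card_gt0P[y] : 0 < #|nbh e S| by lia.
by rewrite inE => /andP[yS /exists_inP[x xS exy]]; exists x, y.
Qed.

(** Otherwise connectedness gives an edge from a cycle vertex w to some u off the cycle. Opening the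
    cycle at an edge at w other than ab and prepending u yields a longer path through ab. *)
Lemma cycle_spans s z p : maxpath e a b s -> hpath e a b (z :: p) -> e (last z p) z ->
  size (z :: p) = size s -> forall u, u \in z :: p.
Proof.
move=> [_ M] /and3P[uc /eplus_adjP sc cab] elz Es u0.
apply: contraT => u0c; exfalso.
have noext u q : u \notin z :: p -> perm_eq q (z :: p) ->
    (forall v v', adj q v v' -> eplus e a b v v') -> adj q a b ->
    e u (head u q) -> False.
  move=> up P so qab eu.
  have : hpath e a b (u :: q).
    rewrite /hpath cons_uniq (perm_mem P) up (perm_uniq P) uc andTb.
    case: q P so qab eu => [|v q] P so qab eu //.
    rewrite adj_cons2 qab !orbT andbT [sorted _ _]/(eplus e a b u v && sorted _ (v :: q)).
    by rewrite {1}/eplus eu; apply/eplus_adjP.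
  by move/M; rewrite -Es /= (perm_size P) ltnn.
have [||w [u [wS uS ewu]]] := @joined_connected [set x in z :: p].
- by apply/set0Pn; exists z; rewrite inE mem_head.
- by apply/eqP/setP => /(_ u0); rewrite !inE -in_cons (negbTE u0c).
move: wS uS; rewrite [w \in _]inE [u \in _]inE => wc uc'.
have euw : e u w by rewrite e_sym.
have [Ez|wz] := eqVneq w z.
  apply: (noext u (z :: p)) => //.
  by rewrite -Ez.
have [s1 [z1 [s2 E]]] := split_in wc wz.
have [h [q Eh]] : exists h q, rcons s1 z1 = h :: q by case: (s1) => [|h q]; [exists z1, [::]|exists h, (rcons q z1)].
have Eh' : h = z by move: E; rewrite Eh => -[].
have [k [k' Ek]] : exists k k', w :: s2 = rcons k k' by exists (belast w s2), (last w s2); rewrite lastI.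
have Ek' : k' = last z p by rewrite -[last z p]/(last z (z :: p)) E Ek last_cat last_rcons.
have [F|nF] := boolP (forced a b z1 w); last first.
  apply: (noext u ((w :: s2) ++ rcons s1 z1)) => //.
  - by rewrite E perm_catC.
  - move=> v v'; rewrite Ek Eh adj_cat -Ek -Eh => /or4P[H|/andP[/eqP<- /eqP<-]|/andP[/eqP<- /eqP<-]|H].
    + by apply: sc; rewrite E adj_cat H !orbT.
    + by rewrite /eplus Eh' Ek' elz.
    + by rewrite /eplus Eh' Ek' e_sym elz.
    + by apply: sc; rewrite E adj_cat H.
  - rewrite Ek Eh adj_cat -Ek -Eh.
    move: cab; rewrite E adj_cat => /or4P[->|/andP[/eqP zE /eqP wE]|/andP[/eqP zE /eqP wE]|->]; rewrite ?orbT //.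
      by case/negP: nF; rewrite zE wE /forced !eqxx.
    by case/negP: nF; rewrite zE wE /forced !eqxx orbT.
(* Now the cycle edge before w is ab, so the cycle is opened just after w and traversed backwards
   from w. *)
have az : adj (rcons (rcons s1 z1) w) a b.
  rewrite adj_rcons2; move: F; rewrite /forced.
  by case/orP=> /andP[-> ->]; rewrite ?orbT.
case: s2 E Ek => [|k0 s2] E Ek.
  apply: (noext u (rev (z :: p))) => //.
  - by rewrite perm_rev.
  - by move=> v v'; rewrite adj_rev; exact: sc.
  - by rewrite adj_rev.
  - by rewrite E cats1 rev_rcons.
have E' : z :: p = rcons (rcons s1 z1) w ++ k0 :: s2 by rewrite E [RHS]cat_rcons.
have [k2 Ek2] : exists k2, k0 :: s2 = rcons k2 k'.
  exists (belast k0 s2); rewrite lastI; congr rcons.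
  by rewrite -[LHS]/(last w (w :: k0 :: s2)) Ek last_rcons.
have adjE v v' : adj (rev (rcons (rcons s1 z1) w) ++ rev (k0 :: s2)) v v' =
    [|| adj (rcons (rcons s1 z1) w) v v', (h == v) && (k' == v'),
        (h == v') && (k' == v) | adj (k0 :: s2) v v'].
  have -> : rcons (rcons s1 z1) w = h :: rcons q w by rewrite Eh.
  by rewrite Ek2 rev_rcons rev_cons adj_cat -rev_cons -rev_rcons !adj_rev.
apply: (noext u (rev (rcons (rcons s1 z1) w) ++ rev (k0 :: s2))) => //.
- by rewrite E'; apply: perm_cat; rewrite perm_rev.
- move=> v v'; rewrite adjE.
  case/or4P=> [H|/andP[/eqP<- /eqP<-]|/andP[/eqP<- /eqP<-]|H].
  + by apply: sc; rewrite E' adj_cat H.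
  + by rewrite /eplus Eh' Ek' e_sym elz.
  + by rewrite /eplus Eh' Ek' elz.
  + by apply: sc; rewrite E' adj_cat H !orbT.
- by rewrite adjE az.
- by rewrite rev_rcons.
Qed.

Definition ham_path (U : {set T}) x y p :=
  [/\ path e x p, last x p = y, uniq (x :: p) & x :: p =i U].

Lemma ham_path_rev U x y p : ham_path U x y p ->
  exists q, ham_path U y x q.
Proof.
case=> pe l u mU; exists (rev (belast x p)); split.
- by rewrite -l (@eq_path _ _ (fun z => e^~ z)) ?rev_path // => ? ?; rewrite e_sym.
- by case: p l {pe u mU} => [|z p] /= <- //; rewrite rev_cons last_rcons.
- by rewrite -l -rev_rcons -lastI rev_uniq.
- by move=> z; rewrite -l -rev_rcons -lastI mem_rev mU.
Qed.

Lemma cycle_ham_path s z p : maxpath e a b s -> hpath e a b (z :: p) -> e (last z p) z ->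
  size (z :: p) = size s -> 2 < #|T| -> exists q, ham_path setT a b q.
Proof.
move=> M H elz Es T2.
have sp := cycle_spans M H elz Es.
case/and3P: H => uc /eplus_adjP sc cab.
have [s1 [u [v [s2 [E uv]]]]] := adj_split cab.
have [h [q Eh]] : exists h q, rcons s1 u = h :: q by case: (s1) => [|h q]; [exists u, [::]|exists h, (rcons q u)].
have Eh' : h = z by move: E; rewrite Eh => -[].
have [k [k' Ek]] : exists k k', v :: s2 = rcons k k' by exists (belast v s2), (last v s2); rewrite lastI.
have Ek' : k' = last z p by rewrite -[last z p]/(last z (z :: p)) E Ek last_cat last_rcons.
have P : perm_eq ((v :: s2) ++ rcons s1 u) (z :: p) by rewrite E perm_catC.
have un : uniq ((v :: s2) ++ rcons s1 u) by rewrite (perm_uniq P).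
have sz : size ((v :: s2) ++ rcons s1 u) = #|T|.
  rewrite -(card_uniqP un); apply: eq_card => x.
  by rewrite (perm_mem P) sp.
have eu : size (s2 ++ s1) = #|T|.-2 by move: sz; rewrite size_cat size_rcons /= size_cat => <-; lia.
have iv : index v ((v :: s2) ++ rcons s1 u) = 0 by rewrite /= eqxx.
have iu : index u ((v :: s2) ++ rcons s1 u) = #|T|.-1.
  have : u \notin (v :: s2) ++ s1.
    by move: un; rewrite -rcons_cat rcons_uniq => /andP[].
  rewrite -rcons_cat -cats1 index_cat => /negbTE->; rewrite /= eqxx addn0.
  by rewrite -sz -rcons_cat size_rcons.
have so : sorted e ((v :: s2) ++ rcons s1 u).
  apply/(sorted_adjP _ e_sym) => x y axy.
  have : eplus e a b x y.
    move: (axy); rewrite Ek Eh adj_cat -Ek -Eh => /or4P[H|/andP[/eqP<- /eqP<-]|/andP[/eqP<- /eqP<-]|H].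
    + by apply: sc; rewrite E adj_cat H !orbT.
    + by rewrite /eplus Eh' Ek' elz.
    + by rewrite /eplus Eh' Ek' e_sym elz.
    + by apply: sc; rewrite E adj_cat H.
  (* A consecutive pair equal to a and b would consist of the last vertex u and the first vertex v,
     which are not consecutive since there are more than two vertices. *)
  case/orP=> // F; exfalso.
  have : adj ((v :: s2) ++ rcons s1 u) u v.
    move: F; rewrite /forced => /orP[]/andP[/eqP xE /eqP yE]; subst x y;
    by case: uv => -[Eu Ev]; subst u v; rewrite // adjC.
  by move/(adj_index un); rewrite iv iu; lia.
have [r Er] : exists r, (v :: s2) ++ rcons s1 u = v :: r by exists (s2 ++ rcons s1 u).
have HP : ham_path setT v u r.
  split; rewrite -?Er //.
  - by move: so; rewrite Er.
  - by rewrite -[last v r]/(last v (v :: r)) -Er last_cat last_rcons.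
  - by move=> x; rewrite (perm_mem P) sp inE.
case: uv => -[Eu Ev]; subst u v; last by exists r.
exact: ham_path_rev HP.
Qed.

End Closing.

(** * Intact segments and Hamilton-connectedness *)

(** Factor by factor, 4 r - i <= 8 (r - i). This is the price of guessing j good segments among 4 r
    when r of them are good; two families cost 64^j. *)
Lemma bin_ratio r j : (2 * j <= r)%N -> ('C(4 * r, j) <= 8 ^ j * 'C(r, j))%N.
Proof.
move=> jr; rewrite -(leq_pmul2r (fact_gt0 j)) -mulnA !bin_ffact.
elim: j jr => [|j IH] jr; first by rewrite !ffactn0.
have H : (4 * r - j <= 8 * (r - j))%N by lia.
rewrite !ffactnSr expnSr mulnACA; apply: leq_mul => //.
by apply: IH; lia.
Qed.

Lemma card_pairs_ge (I J : finType) (S : {set I * J}) (E : {set J}) (c d : nat) :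
  (forall y, y \in E -> c <= d * #|[set x | (x, y) \in S]|)%N -> (c * #|E| <= d * #|S|)%N.
Proof.
move=> H; have -> : #|S| = (\sum_y \sum_x ((x, y) \in S))%N.
  rewrite exchange_big pair_bigA /= -sum1_card big_mkcond /=.
  by apply: eq_bigr => -[x y] _ /=; case: (_ \in _).
rewrite mulnC -sum_nat_const big_distrr /= [leqRHS](bigID (mem E)) /=.
apply: leq_trans (leq_addr _ _); apply: leq_sum => y /H /leq_trans; apply.
rewrite leq_mul2l; apply/orP; right.
by rewrite -sum1_card big_mkcond leq_sum // => x _; rewrite inE; case: (_ \in _).
Qed.

Lemma popular (I J : finType) (S : {set I}) (X : {set J}) (r : I -> J -> bool) (c d : nat) :
  (forall x, x \in S -> c <= #|[set y in X | r x y]|)%N -> (d * #|X| < c * #|S|)%N ->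
  exists2 y, y \in X & (d < #|[set x in S | r x y]|)%N.
Proof.
move=> H cd; apply/exists_inP; apply: contraT; rewrite negb_exists_in => /forall_inP small.
suff : (c * #|S| <= d * #|X|)%N by rewrite leqNgt cd.
apply: (@leq_trans (\sum_(x in S) \sum_(y in X) r x y)).
  rewrite mulnC -sum_nat_const leq_sum // => x /H /leq_trans; apply.
  rewrite -sum1_card (eq_bigl (fun y => (y \in X) && r x y)).
    by rewrite big_mkcondr leq_sum // => y _; case: (r x y).
  by move=> y; rewrite inE.
rewrite exchange_big /= mulnC -sum_nat_const leq_sum // => y /small; rewrite -leqNgt.
apply: leq_trans; rewrite -sum1_card [leqRHS](eq_bigl (fun x => (x \in S) && r x y)).
  by rewrite [leqRHS]big_mkcondr leq_sum // => x _; case: (r x y).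
by move=> x; rewrite inE.
Qed.

Section AdjRestrict.
Local Open Scope nat_scope.
Variable T : eqType.
Implicit Types (s L R : seq T) (x y u w : T).

Lemma adj_prefix L u w R x y : uniq (rcons L u ++ w :: R) -> x \in rcons L u ->
  y \in rcons L u -> adj (rcons L u ++ w :: R) x y = adj (rcons L u) x y.
Proof.
rewrite cat_uniq => /and3P[_ /hasPn H _] xL yL.
have wR v : v \in rcons L u -> v \notin w :: R by move=> vL; apply/negP => /H; rewrite /= vL.
have wy v : v \in rcons L u -> (w == v) = false.
  by move=> /wR; rewrite inE negb_or eq_sym => /andP[/negbTE].
rewrite adj_cat (wy _ xL) (wy _ yL) !andbF !orFb orbC.
by have /negbTE-> : ~~ adj (w :: R) x y by apply: contra (wR _ xL) => /adj_meml.
Qed.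

Lemma adj_suffix L u w R x y : uniq (rcons L u ++ w :: R) -> x \in w :: R ->
  y \in w :: R -> adj (rcons L u ++ w :: R) x y = adj (w :: R) x y.
Proof.
move=> un xR yR; rewrite -adj_rev rev_cat rev_cons rev_rcons adj_prefix; first by rewrite -rev_cons adj_rev.
- by rewrite -rev_cons -rev_rcons -rev_cat rev_uniq.
- by rewrite -rev_cons mem_rev.
- by rewrite -rev_cons mem_rev.
Qed.

Lemma adj_cross L u w R x y : uniq (rcons L u ++ w :: R) -> x \in rcons L u ->
  y \notin rcons L u -> adj (rcons L u ++ w :: R) x y -> x = u.
Proof.
rewrite cat_uniq => /and3P[_ /hasPn H _] xL yL; rewrite adj_cat.
case/or4P=> [/adj_memr|/andP[/eqP-> _]|/andP[/eqP E _]|/adj_meml/H] //.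
- by rewrite (negbTE yL).
- by move: yL; rewrite -E mem_rcons mem_head.
- by rewrite /= xL.
Qed.

End AdjRestrict.

(** * Segments of a path *)

Section Segments.
Local Open Scope nat_scope.
Variables (T : finType) (s0 : seq T) (q K : nat).
Hypotheses (us0 : uniq s0) (q0 : 0 < q) (Kq : K * q <= size s0).

Definition seg (i : nat) : {set T} := [set y in s0 | index y s0 %/ q == i].

Definition segs (J : {set 'I_K}) : {set T} :=
  [set y in s0 | [exists i in J, index y s0 %/ q == i]].

Lemma segsP (J : {set 'I_K}) y : reflect (exists2 i, i \in J & y \in seg i) (y \in segs J).
Proof.
rewrite inE; apply: (iffP andP) => [[ys /exists_inP[i iJ H]]|[i iJ]].
  by exists i; rewrite // inE ys.
by rewrite inE => /andP[-> H]; split=> //; apply/exists_inP; exists i.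
Qed.

Lemma mem_seg_nth y0 (i k : nat) : i < K -> k < q -> nth y0 s0 (i * q + k) \in seg i.
Proof.
move=> iK kq; have sz : i * q + k < size s0.
  by apply: leq_trans Kq; apply: (@leq_trans (i.+1 * q)); [rewrite mulSn; lia|rewrite leq_mul2r iK orbT].
by rewrite inE mem_nth // index_uniq // divnMDl // divn_small // addn0 eqxx.
Qed.

Lemma seg_nth y0 i y : y \in seg i ->
  exists2 k, k < q & y = nth y0 s0 (i * q + k).
Proof.
rewrite inE => /andP[ys /eqP E]; exists (index y s0 %% q); first by rewrite ltn_mod.
by rewrite -E -divn_eq nth_index.
Qed.

Lemma card_segs (J : {set 'I_K}) : #|J| * q <= #|segs J|.
Proof.
have [->|[i iJ]] := set_0Vmem J; first by rewrite cards0.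
have y0 : T.
  have : 0 < size s0.
    by apply: leq_trans Kq; rewrite muln_gt0 q0 andbT; apply: leq_trans (ltn_ord i).
  by case: (s0) => // y.
pose f (p : 'I_K * 'I_q) := nth y0 s0 (p.1 * q + p.2).
have small (p : 'I_K * 'I_q) : p.1 * q + p.2 < size s0.
  apply: leq_trans Kq; apply: (@leq_trans (p.1.+1 * q)).
    by rewrite mulSn; have := ltn_ord p.2; lia.
  by rewrite leq_mul2r ltn_ord orbT.
have finj : injective f.
  move=> p p' /eqP; rewrite /f nth_uniq // => /eqP E.
  have D x (k : 'I_q) : (x * q + k) %/ q = x by rewrite divnMDl // divn_small // addn0.
  have E1 : nat_of_ord p.1 = p'.1 by have := congr1 (divn^~ q) E; rewrite /= !D.
  have E2 : nat_of_ord p.2 = p'.2 by move: E; rewrite E1; lia.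
  by case: p p' E1 E2 {E} => [x y] [x' y'] /= /val_inj-> /val_inj->.
have <- : #|setX J [set: 'I_q]| = #|J| * q by rewrite cardsX cardsT card_ord.
rewrite -(card_imset _ finj); apply/subset_leq_card/subsetP => y /imsetP[[k l] /setXP[kJ _] ->].
by apply/segsP; exists k => //; exact: mem_seg_nth.
Qed.

(** A vertex outside the interior is the first or last of its segment or a path neighbour of a or
    b. *)
Lemma card_segs_boundary (J : {set 'I_K}) (a b : T) :
  #|(segs J :\: [set a; b]) :\: inner s0 (segs J :\: [set a; b])| <= 2 * #|J| + 4.
Proof.
set C := segs J :\: [set a; b].
have [->|[z zC]] := set_0Vmem (C :\: inner s0 C); first by rewrite cards0.
have : C :\: inner s0 C \subset
    \bigcup_(i in J) [set nth z s0 (i * q); nth z s0 (i * q + q.-1)] :|: nbs s0 [set a; b].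
  apply/subsetP => y; rewrite inE [y \in inner _ _]inE => /andP[+ yC].
  rewrite yC /= => /subsetPn[w]; rewrite inE => ad wC.
  rewrite in_setU; have [wab|wab] := boolP (w \in [set a; b]).
    by apply/orP; right; apply/bigcupP; exists w; rewrite // inE.
  have ws := adj_meml ad; have ys := adj_memr ad.
  have /segsP[i iJ yi] : y \in segs J by move: yC; rewrite inE => /andP[].
  have wi : index w s0 %/ q != i.
    apply: contra wC => wi; rewrite inE wab /=; apply/segsP; exists i => //.
    by rewrite inE ws.
  apply/orP; left; apply/bigcupP; exists i => //.
  have [k kq Ey] := seg_nth z yi.
  have Ei : index y s0 = i * q + k.
    have sz : i * q + k < size s0.
      have : i.+1 * q <= K * q by rewrite leq_mul2r ltn_ord orbT.
      by rewrite mulSn; lia.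
    by rewrite Ey index_uniq.
  have D j l : l < q -> (j * q + l) %/ q = j by move=> lq; rewrite divnMDl // divn_small // addn0.
  rewrite !inE; case/orP: (adj_index us0 ad) => /eqP E.
    have [k0|k0] := posnP k; first by rewrite Ey k0 addn0 eqxx.
    case/negP: wi; rewrite Ei in E.
    have -> : index w s0 = i * q + k.-1 by lia.
    by rewrite D //; lia.
  have [kq1|kq1] := eqVneq k q.-1; first by rewrite Ey kq1 eqxx orbT.
  case/negP: wi; rewrite Ei in E.
  have -> : index w s0 = i * q + k.+1 by lia.
  by rewrite D //; lia.
move/subset_leq_card/leq_trans; apply.
apply: leq_trans (leq_of_leqif (leq_card_setU _ _)) _; apply: leq_add.
  by apply: card_bigcup_le => i _; rewrite cards2; case: (_ != _).
apply: leq_trans (card_nbs _ us0) _.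
by rewrite cards2; case: (_ != _).
Qed.

Lemma card_seg_hit (H : {set T}) : #|[set i : 'I_K | ~~ [disjoint seg i & H]]| <= #|H|.
Proof.
have : [set i : 'I_K | ~~ [disjoint seg i & H]] \subset
    \bigcup_(h in H) [set i : 'I_K | index h s0 %/ q == i].
  apply/subsetP => i; rewrite inE -setI_eq0 => /set0Pn[h]; rewrite !inE => /andP[/andP[_ E] hH].
  by apply/bigcupP; exists h; rewrite ?inE.
move/subset_leq_card/leq_trans; apply; rewrite -[leqRHS]mul1n; apply: card_bigcup_le => h _.
apply/card_le1_eqP => i j; rewrite !inE => /eqP Ei /eqP Ej.
by apply: val_inj; rewrite -[val i]Ei -[val j]Ej.
Qed.

End Segments.

(** * Closing a longest path to a cycle *)

Section HamiltonConnected.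
Local Open Scope nat_scope.
Variables (T : finType) (e : rel T).
Hypotheses (e_sym : symmetric e) (e_irr : irreflexive e).
Variables m t j q : nat.
Hypotheses (eE : expands e m) (eJ : joined e m) (m0 : 0 < m).
Variables a b : T.
Hypothesis ab : a != b.

(** Two rounds of t + 1 rotations meet at most k heads; with their path neighbours these are at most
    r vertices, so at least 3 r of the K segments avoid them. This suffices for r segments before a
    cut, one at the cut and r after it. *)
Let k := 2 * t + 4.
Let r := 3 * k.
Let K := 4 * r.

Hypotheses (Hm : 4 * (m + 2) <= #|T|) (Ht : m <= 2 ^ t) (Hj : 2 * j <= r).
Hypotheses (HK : 4 * (K * q) <= #|T|) (HC : 2 * j + 6 + 13 * m <= j * q).
Hypothesis (HN : 32 * m * 64 ^ j < #|T|).

Let q0 : 0 < q.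
Proof. by move: HC; case: (q) => //; rewrite muln0; lia. Qed.

Variable s0 : seq T.
Hypothesis M0 : maxpath e a b s0.

Let us0 : uniq s0. Proof. by case: M0 => /hpath_uniq. Qed.

Let Kq : K * q <= size s0.
Proof.
have := ends_large e_sym e_irr eE eJ ab M0 m0 Ht Hm.
have : #|ends e a b s0 t.+1| <= size s0.
  rewrite -(card_uniqP us0); apply/subset_leq_card/subsetP => x; exact: ends_mem.
lia.
Qed.

Definition intact s1 (H : {set T}) s := forall v, v \notin H ->
  (forall w, adj s1 w v -> w \notin H) -> forall w, adj s w v = adj s1 w v.

(* [H] contains the heads met while rotating [s0] into [s]; edges of [s0] away from
   [H] survive. *)
Definition endpair x y := exists s (H : {set T}),
  [/\ maxpath e a b s, perm_eq s s0, #|H| <= k, intact s0 H s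
    & exists2 p, s = x :: p & last x p = y].

(** For each of the n/4 heads y obtained from [s0], the reversed path is again a longest one and is
    rotated at its other end, which gives n/4 choices of x. *)
Lemma many_endpairs : #|T| ^ 2 <= 16 * #|[set z : T * T | `[< endpair z.1 z.2 >]]|.
Proof.
have L1 := ends_large e_sym e_irr eE eJ ab M0 m0 Ht Hm.
suff : #|T| * #|ends e a b s0 t.+1| <= 4 * #|[set z : T * T | `[< endpair z.1 z.2 >]]|.
  by rewrite expnS expn1 => H; have := leq_mul (leqnn #|T|) L1; lia.
apply: card_pairs_ge => y /endsP[Z [p R1]].
have M1 := maxpath_rev e_sym (rots_maxpath e_sym M0 R1).
apply: leq_trans (ends_large e_sym e_irr eE eJ ab M1 m0 Ht Hm) _.
rewrite leq_mul2l; apply/subset_leq_card/subsetP => x /endsP[Z' [p' R2]].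
rewrite !inE; apply/asboolP; exists (x :: p'), (Z :|: Z'); split.
- exact: rots_maxpath R2.
- by rewrite (permPl (rots_perm R2)) perm_rev (rots_perm R1).
- apply: leq_trans (leq_of_leqif (leq_card_setU _ _)) _.
  by have := rots_card R1; have := rots_card R2; rewrite /k; lia.
- move=> v; rewrite inE negb_or => /andP[vZ vZ'] nb w.
  have nbZ : forall w, adj s0 w v -> w \notin Z.
    by move=> z /nb; rewrite inE negb_or => /andP[].
  rewrite (rots_intact R2) // ?adj_rev ?(rots_intact R1) // => z.
  by rewrite adj_rev (rots_intact R1) // => /nb; rewrite inE negb_or => /andP[].
- exists p' => //; have := rots_last y R2.
  by rewrite rev_cons last_rcons.
Qed.

Definition cutpair x y (J1 J2 : {set 'I_K}) := exists L u w R,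
  [/\ maxpath e a b (rcons L u ++ w :: R) /\ size (rcons L u ++ w :: R) = size s0,
      exists L', rcons L u = x :: L', exists R', w :: R = rcons R' y,
      {subset segs s0 q J1 <= rcons L u} /\ {subset segs s0 q J2 <= w :: R}
    & forall v, v \in segs s0 q J1 :|: segs s0 q J2 ->
        forall z, adj (rcons L u ++ w :: R) z v = adj s0 z v].

(* Cutting [s] anywhere splits at most one intact segment, as the vertices of such a
   segment are consecutive in [s]; so the number of intact segments before the cut
   grows by steps of at most one. *)
Lemma endpair_cut x y : endpair x y -> exists F G : {set 'I_K},
  [/\ r <= #|F|, r <= #|G| & forall J1 J2 : {set 'I_K},
      J1 \subset F -> J2 \subset G -> cutpair x y J1 J2].
Proof.
case=> s [H [M P Hk I [p Es Ep]]].
have us : uniq s by rewrite (perm_uniq P).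
pose H' := H :|: nbs s0 H.
have H'r : #|H'| <= r.
  apply: leq_trans (leq_of_leqif (leq_card_setU _ _)) _.
  by have := card_nbs H us0; rewrite /r; lia.
pose U := [set i : 'I_K | [disjoint seg s0 q i & H']].
have U3 : 3 * r <= #|U|.
  have := card_seg_hit s0 q K H'; have := cardsC U.
  rewrite card_ord (_ : ~: U = [set i : 'I_K | ~~ [disjoint seg s0 q i & H']]).
    by rewrite /K; lia.
  by apply/setP => i; rewrite !inE.
have IU i v : i \in U -> v \in seg s0 q i -> forall z, adj s z v = adj s0 z v.
  rewrite inE => dis vi; have := disjointFr dis vi; rewrite inE => /negbT.
  rewrite negb_or => /andP[vH vn]; apply: I => // w ad; apply: contra vn => wH.
  by apply/bigcupP; exists w; rewrite ?inE.
have segne i : i < K -> exists v, v \in seg s0 q i.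
  by move=> iK; exists (nth x s0 (i * q + 0)); exact: mem_seg_nth us0 q0 Kq _ _ _ iK q0.
pose F c := [set i in U | [forall v in seg s0 q i, v \in take c s]].
have Fex : exists c, r <= #|F c|.
  exists (size s); apply: leq_trans (_ : r <= #|U|) _; first by lia.
  apply/subset_leq_card/subsetP => i iU; rewrite inE iU; apply/forall_inP => v.
  by rewrite inE take_size (perm_mem P) => /andP[].
case: (ex_minnP Fex) => -[|c] Fr Fmin.
  have /card_gt0P[i] : 0 < #|F 0| by apply: leq_trans Fr; rewrite /r /k; lia.
  rewrite inE take0 => /andP[_ /forall_inP H0].
  by have [v /H0] := segne i (ltn_ord i).
have csz : c < size s.
  rewrite ltnNge; apply/negP => sc.
  have := Fmin c; rewrite (_ : F c = F c.+1) ?Fr ?ltnn; first by move=> /(_ isT).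
  by rewrite /F !take_oversize // ltnW.
pose z := nth x s c.
have Et : take c.+1 s = rcons (take c s) z by rewrite (take_nth x).
pose Z := [set i : 'I_K | z \in seg s0 q i].
have Z1 : #|Z| <= 1.
  apply/card_le1_eqP => i i'; rewrite !inE => /andP[_ /eqP E] /andP[_ /eqP E'].
  by apply: val_inj; rewrite -[val i]E -[val i']E'.
have FcZ : F c.+1 \subset F c :|: Z.
  apply/subsetP => i; rewrite !inE => /andP[-> /forall_inP Hi].
  have [zi|zi] := boolP (z \in seg s0 q i).
    by move: zi; rewrite inE => ->; rewrite orbT.
  apply/orP; left; apply/forall_inP => v vi; have := Hi v vi.
  rewrite Et mem_rcons inE => /orP[/eqP vz|//].
  by rewrite -vz vi in zi.
have Fc : #|F c.+1| <= r.
  have : #|F c| < r by rewrite ltnNge; apply/negP => /Fmin; rewrite ltnn.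
  have := subset_leq_card FcZ; have := leq_of_leqif (leq_card_setU (F c) Z); lia.
have r0 : 0 < r by rewrite /r /k; lia.
have [w [R Ed]] : exists w R, drop c.+1 s = w :: R.
  case Ed : (drop c.+1 s) => [|w R]; last by exists w, R.
  have : U \subset F c.+1.
    apply/subsetP => i iU; rewrite inE iU; apply/forall_inP => v.
    rewrite inE => /andP[vs _].
    by rewrite -(cats0 (take _ _)) -Ed cat_take_drop (perm_mem P).
  by move/subset_leq_card; lia.
have Esz : s = rcons (take c s) z ++ w :: R by rewrite -Et -Ed cat_take_drop.
pose G := [set i in U | [forall v in seg s0 q i, v \in w :: R]].
have UFG : U \subset F c.+1 :|: G :|: Z.
  apply/subsetP => i iU; rewrite !in_setU.
  have [|zi] := boolP (z \in seg s0 q i); first by move=> zi; rewrite [i \in Z]inE zi !orbT.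
  have side l : l < q -> (nth x s0 (i * q + l) \in take c.+1 s) =
                         (nth x s0 (i * q) \in take c.+1 s).
    elim: l => [|l IH] lq; first by rewrite addn0.
    have s1 := mem_seg_nth us0 q0 Kq x (ltn_ord i) lq.
    have s2 := mem_seg_nth us0 q0 Kq x (ltn_ord i) (ltnW lq).
    have ad : adj s (nth x s0 (i * q + l)) (nth x s0 (i * q + l.+1)).
      rewrite (IU i) // addnS; apply: adj_nth.
      apply: leq_trans Kq; apply: (@leq_trans (i.+1 * q)); last by rewrite leq_mul2r ltn_ord orbT.
      by rewrite mulSn -addnS addnC ltn_add2r.
    rewrite -IH ?(ltnW lq) // Et; apply/idP/idP => A; apply: contraT => B.
      rewrite adjC Esz in ad; have := adj_cross _ A B ad; rewrite -Esz => /(_ us) E.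
      by rewrite -E s1 in zi.
    rewrite Esz in ad; have := adj_cross _ A B ad; rewrite -Esz => /(_ us) E.
    by rewrite -E s2 in zi.
  rewrite -orbA; apply/orP.
  have [A|A] := boolP (nth x s0 (i * q) \in take c.+1 s); [left|right; apply/orP; left];
    rewrite inE iU; apply/forall_inP => v vi; have [l lq Ev] := seg_nth q0 x vi;
    have := side l lq; rewrite -Ev.
    by rewrite A.
  rewrite (negbTE A) => /negbT.
  have : v \in s by rewrite (perm_mem P); move: vi; rewrite inE => /andP[].
  by rewrite -{1}(cat_take_drop c.+1 s) mem_cat Ed => /orP[->|].
exists (F c.+1), G; split=> //.
  have UFGZ : #|U| <= #|F c.+1| + #|G| + #|Z|.
    apply: leq_trans (subset_leq_card UFG) _.
    apply: leq_trans (leq_of_leqif (leq_card_setU _ _)) _; rewrite leq_add2r.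
    exact: leq_of_leqif (leq_card_setU _ _).
  move: Fc Z1 U3 UFGZ r0; move: #|F c.+1| #|G| #|Z| #|U| r => f g cz u r'; clear; lia.
move=> J1 J2 J1F J2G; exists (take c s), z, w, R; rewrite -Esz; split.
- by split=> //; rewrite (perm_size P).
- rewrite -Et Es /=; by eexists.
- exists (belast w R); rewrite lastI; congr rcons.
  by rewrite -Ep -[RHS]/(last x (x :: p)) -Es Esz last_cat.
- split=> v /segsP[i iJ vi].
    have := subsetP J1F i iJ; rewrite inE -Et => /andP[_ /forall_inP]; exact.
  have := subsetP J2G i iJ; rewrite inE => /andP[_ /forall_inP]; exact.
- move=> v; rewrite in_setU => /orP[]/segsP[i iJ vi].
    by apply: IU vi; have := subsetP J1F i iJ; rewrite inE => /andP[].
  by apply: IU vi; have := subsetP J2G i iJ; rewrite inE => /andP[].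
Qed.

(** At least n^2/16 pairs of ends admit C(r, j)^2 pairs of families each, out of at most 64^j C(r,
    j)^2 in all. Some pair of families thus serves n^2 / (16 · 64^j) pairs of ends, more than 2 m n
    by [HN]. *)
Lemma popular_cut : exists J1 J2 : {set 'I_K}, [/\ #|J1| = j, #|J2| = j
  & 2 * m * #|T| < #|[set z : T * T | `[< cutpair z.1 z.2 J1 J2 >]]|].
Proof.
pose S := [set z : T * T | `[< endpair z.1 z.2 >]].
pose D := [set A : {set 'I_K} | #|A| == j].
pose P (z : T * T) (J : {set 'I_K} * {set 'I_K}) := `[< cutpair z.1 z.2 J.1 J.2 >].
have [||J] := @popular _ _ S (setX D D) P ('C(r, j) ^ 2) (2 * m * #|T|).
- move=> z; rewrite inE => /asboolP/endpair_cut[F [G [Fr Gr HJ]]].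
  apply: (@leq_trans #|setX [set A : {set 'I_K} | A \subset F & #|A| == j]
                            [set A : {set 'I_K} | A \subset G & #|A| == j]|).
    by rewrite cardsX !cards_draws expnS expn1 leq_mul // leq_bin2l.
  apply/subset_leq_card/subsetP => -[A B]; rewrite !inE /= => /andP[/andP[AF ->] /andP[BG ->]].
  by apply/asboolP; apply: HJ.
- rewrite cardsX card_draws card_ord -/S.
  have := many_endpairs; rewrite -/S => S16.
  have B := bin_ratio Hj; rewrite -/K in B.
  have B2 : 'C(K, j) * 'C(K, j) <= 64 ^ j * 'C(r, j) ^ 2.
    by apply: leq_trans (leq_mul B B) _; rewrite mulnACA -expnMn expnS expn1.
  have C0 : 0 < 'C(r, j) ^ 2 by rewrite expn_gt0 bin_gt0; apply/orP; left; lia.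
  have H : 16 * (2 * m * #|T| * 64 ^ j) < 16 * #|S|.
    apply: leq_trans S16; rewrite expnS expn1.
    rewrite (_ : 16 * _ = (32 * m * 64 ^ j) * #|T|); first by rewrite ltn_pmul2r //; lia.
    by rewrite !mulnA; nia.
  apply: leq_ltn_trans (leq_mul (leqnn _) B2) _.
  rewrite mulnA mulnC ltn_pmul2l //; lia.
- rewrite !inE => /andP[/eqP J1 /eqP J2] H; exists J.1, J.2; split=> //.
  apply: leq_trans H _; apply/subset_leq_card/subsetP => z; rewrite !inE => /andP[_ H].
  exact: H.
Qed.

(** The cores are built from the two families and [s0] alone, before a pair of ends is chosen. Fewer
    than m vertices are bad for each core, which excludes at most 2 m n pairs; a surviving pair
    reaches m heads on either side of the cut. *)
Lemma maxpath_closes : exists z p, [/\ hpath e a b (z :: p), e (last z p) z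
  & size (z :: p) = size s0].
Proof.
have [J1 [J2 [c1 c2 big]]] := popular_cut.
pose C (J : {set 'I_K}) := segs s0 q J :\: [set a; b].
have coreJ (J : {set 'I_K}) : #|J| = j -> exists D : {set T},
    [/\ D \subset C J, 2 * m <= #|inner s0 D| & core_expands e m s0 D].
  move=> cJ; apply: (core_exists eJ m0 us0 (bd := 2 * j + 4)).
    by rewrite -cJ; apply: card_segs_boundary.
  have := card_segs us0 q0 Kq J; rewrite cJ.
  have := cardsD (segs s0 q J) [set a; b].
  have := subset_leq_card (finset.subsetIr (segs s0 q J) [set a; b]).
  rewrite cards2 /C; case: (_ != _) => /=; lia.
have [D1 [D1C D1i D1e]] := coreJ J1 c1.
have [D2 [D2C D2i D2e]] := coreJ J2 c2.
pose B (D : {set T}) := [set v | ~~ [exists y in inner s0 D, e v y]].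
have B1 : #|B D1| < m by apply: few_bad.
have B2 : #|B D2| < m by apply: few_bad.
have : exists2 z, z \in [set z : T * T | `[< cutpair z.1 z.2 J1 J2 >]] &
                  z \notin setX (B D1) setT :|: setX setT (B D2).
  apply/subsetPn; apply: contraL big => /subset_leq_card H; rewrite -leqNgt.
  apply: leq_trans H _; apply: leq_trans (leq_of_leqif (leq_card_setU _ _)) _.
  by rewrite !cardsX cardsT; nia.
case=> -[x y]; rewrite in_setU !in_setX !in_setT andbT andTb negb_or /= inE.
move=> /asboolP[L [u [w [R [[M sz] [L' EL] [R' ER] [sub1 sub2] I]]]]] /andP[xB yB].
have un : uniq (rcons L u ++ w :: R) by case: M => /hpath_uniq.
have good D v : v \notin B D -> exists2 y, y \in inner s0 D & e v y.
  by rewrite inE negbK => /exists_inP.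
have CJ (D : {set T}) J v : D \subset C J -> v \in D -> v \in segs s0 q J.
  by move=> DC /(subsetP DC); rewrite inE => /andP[].
have nab (D : {set T}) J : D \subset C J -> a \notin D /\ b \notin D.
  by move=> DC; split; apply/negP => /(subsetP DC); rewrite !inE eqxx ?orbT.
have [aD1 bD1] := nab _ _ D1C; have [aD2 bD2] := nab _ _ D2C.
have inn D v w0 : v \in inner s0 D -> adj s0 w0 v -> w0 \in D.
  by rewrite inE => /andP[_ /subsetP H] ad; apply: H; rewrite inE.
have innD D v : v \in inner s0 D -> v \in D by apply: (subsetP (inner_sub _ _)).
have [t1] : exists t1, m <= #|ends e a b (x :: L') t1|.
  apply: (ends_core e_irr m0 us0 D1e (good _ _ xB) _ aD1 bD1) => [v vD|v w0 vI].
    by rewrite -EL; apply: sub1; apply: CJ vD.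
  have vS := CJ _ _ _ D1C (innD _ _ vI).
  have vL := sub1 _ vS.
  have E : adj (rcons L u ++ w :: R) w0 v = adj s0 w0 v by apply: I; rewrite inE vS.
  rewrite -EL; apply/idP/idP => [H|H].
    by rewrite -E adj_cat H.
  rewrite -(adj_prefix un) ?E //.
  by apply: sub1; apply: CJ D1C _; apply: inn H.
have ER2 : rev (w :: R) = y :: rev R' by rewrite ER rev_rcons.
have [t2] : exists t2, m <= #|ends e a b (y :: rev R') t2|.
  apply: (ends_core e_irr m0 us0 D2e (good _ _ yB) _ aD2 bD2) => [v vD|v w0 vI].
    by rewrite -ER2 mem_rev; apply: sub2; apply: CJ vD.
  have vS := CJ _ _ _ D2C (innD _ _ vI).
  have vL := sub2 _ vS.
  have E : adj (rcons L u ++ w :: R) w0 v = adj s0 w0 v by apply: I; rewrite inE vS orbT.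
  rewrite -ER2 adj_rev; apply/idP/idP => [H|H].
    by rewrite -E adj_cat H !orbT.
  rewrite -(adj_suffix un) ?E //.
  by apply: sub2; apply: CJ D2C _; apply: inn H.
rewrite -EL -ER2 => m2 m1.
have dis : [disjoint ends e a b (rcons L u) t1 & ends e a b (rev (w :: R)) t2].
  rewrite disjoints_subset; apply/subsetP => v /ends_mem vL; rewrite in_setC.
  apply/negP => /ends_mem; rewrite mem_rev => vR.
  by move: un; rewrite cat_uniq => /and3P[_ /hasP H _]; apply: H; exists v.
have [x' [y' [x1 y1 exy]]] := eJ dis m1 m2.
have [hp _] := M.
have [z [p [hz ez P]]] := close_ends e_sym hp x1 y1 exy.
by exists z, p; split=> //; rewrite -sz; exact: perm_size P.
Qed.

End HamiltonConnected.

Lemma hamilton_connected (T : finType) (e : rel T) (m t j q : nat) :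
  symmetric e -> irreflexive e -> expands e m -> joined e m -> (0 < m)%N ->
  (4 * (m + 2) <= #|T|)%N -> (m <= 2 ^ t)%N -> (j <= 3 * (t + 2))%N ->
  (48 * (2 * t + 4) * q <= #|T|)%N -> (2 * j + 6 + 13 * m <= j * q)%N ->
  (32 * m * 64 ^ j < #|T|)%N ->
  forall a b : T, a != b -> exists p, ham_path e [set: T] a b p.
Proof.
move=> e_sym e_irr eE eJ m0 Hm Ht Hj HK HC HN a b ab.
have [s M] : exists s, maxpath e a b s.
  pose P k := `[< exists s, hpath e a b s /\ size s = k >].
  have P2 : exists k, P k.
    exists 2; apply/asboolP; exists [:: a; b]; split=> //.
    by rewrite /hpath /= inE ab !andbT !eqxx /= /eplus /forced !eqxx orbT.
  have Pb k : P k -> (k <= #|T|)%N.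
    by move=> /asboolP[s [/hpath_uniq us <-]]; rewrite -(card_uniqP us) max_card.
  case: (ex_maxnP P2 Pb) => k /asboolP[s [hs Es]] mx; exists s; split=> // s' hs'.
  by rewrite Es; apply: mx; apply/asboolP; exists s'.
have Hj' : (2 * j <= 3 * (2 * t + 4))%N by lia.
have HK' : (4 * (4 * (3 * (2 * t + 4)) * q) <= #|T|)%N by rewrite !mulnA.
have [z [p [hz ez sz]]] := maxpath_closes e_sym e_irr eE eJ m0 ab Hm Ht Hj' HK' HC HN M.
have T2 : (2 < #|T|)%N by lia.
exact: (cycle_ham_path e_sym eE eJ m0 ab M hz ez sz T2).
Qed.

(** * Parities of Hamilton cycles *)

Section Labels.
Local Open Scope nat_scope.
Variables (T : eqType) (e : rel T).
Implicit Types (r : T -> T -> bool) (x y : T) (p q : seq T).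

Fixpoint lab r x p : bool := if p is y :: p' then r x y (+) lab r y p' else false.

Lemma lab_cat r x p y q :
  lab r x (p ++ y :: q) = lab r x p (+) r (last x p) y (+) lab r y q.
Proof. by elim: p x => [|z p IH] x //=; rewrite IH !addbA. Qed.

(** The inner values of f cancel in pairs. Around a cycle the outer ones cancel too, so only the
    constant can change its parity, according to its length. *)
Lemma lab_shift r (f : T -> bool) (c : bool) x p :
  lab (fun u v => r u v (+) (f u (+) f v) (+) c) x p =
  lab r x p (+) (f x (+) f (last x p)) (+) (c && odd (size p)).
Proof.
elim: p x => [|y p IH] x /=; first by rewrite addbb andbF.
rewrite IH {IH}; case: (f x) (f y) (f (last y p)) c (r x y) (lab r y p) (odd _) => [] [] [] [] [] [] [] //.
Qed.

Lemma lab_zero r (U : pred T) x p : (forall u v, u \in U -> v \in U -> e u v -> r u v = false) ->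
  path e x p -> {subset x :: p <= U} -> lab r x p = false.
Proof.
move=> r0; elim: p x => [|y p IH] x //= /andP[exy pp] sub.
rewrite (r0 x y) ?sub ?inE ?eqxx ?orbT //= IH // => z zp.
by apply: sub; rewrite inE zp orbT.
Qed.

End Labels.

Section Parity.
Local Open Scope nat_scope.
Variables (T : finType) (e : rel T) (L0 : {set T}).
Hypotheses (e_sym : symmetric e) (e_irr : irreflexive e).

(** Nothing restricts what else A contains, because only degrees into A matter later. The 8 is an
    allowance for the vertices that the constructions remove. *)
Definition nearly (M A : {set T}) :=
  exists2 s : seq T, size s <= 8 & forall x, x \in M -> x \notin s -> x \in A.

Definition big A := nearly L0 A \/ nearly (~: L0) A.

Hypothesis HC : forall A x y, big A -> x \in A -> y \in A -> x != y ->
  exists p, ham_path e A x y p.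
(** Connectedness of the graph formed by the edges between A and B, expressed by locally constant
    functions. *)
Hypothesis CO : forall (A B : {set T}) (f : T -> bool), big A -> big B ->
  (forall x y, x \in A -> y \in B -> e x y -> f x = f y) ->
  forall x y, x \in A :|: B -> y \in A :|: B -> f x = f y.
Hypothesis NB : forall v A, big A -> exists2 w, w \in A & e v w.

(** The common parity k is kept general because adding a constant to all labels flips it when the
    number of vertices is odd. *)
Definition ham_parity (r : T -> T -> bool) (k : bool) := forall x p,
  ham_path e setT x (last x p) p -> e (last x p) x ->
  lab r x p (+) r (last x p) x = k.

Implicit Types (r : T -> T -> bool) (k : bool) (A B M : {set T}).

Lemma ham_cat A B x l l' y p q : [disjoint A & B] -> ham_path e A x l p ->
  ham_path e B l' y q -> e l l' -> ham_path e (A :|: B) x y (p ++ l' :: q).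
Proof.
move=> dis [pp lp up mp] [pq lq uq mq] ell'; split.
- by rewrite cat_path pp /= lp ell' pq.
- by rewrite last_cat /= lq.
- rewrite -cat_cons cat_uniq up uq andbT andTb; apply/hasPn => z; rewrite mq mp => zB.
  by rewrite (disjointFl dis zB).
- by move=> z; rewrite -cat_cons mem_cat mp mq inE.
Qed.

(** Stated for all splittings into two big sets, since it is applied again after moving vertices
    across. One Hamilton path is fixed for each x, so that its parity is a function of x alone. *)
Lemma cross_potential r k A l l' : symmetric r -> ham_parity r k -> big A -> big (~: A) ->
  l \in A -> l' \notin A -> e l l' ->
  exists f : T -> bool, forall x y, x \in A -> x != l -> y \notin A -> y != l' -> e x y ->
    r x y = f x (+) f y.
Proof.
move=> r_sym rk bA bA' lA lA' ell'.
have [p Hp] : {p : T -> seq T & forall x, x \in A -> x != l -> ham_path e A x l (p x)}.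
  apply: (choice (P := fun x p => x \in A -> x != l -> ham_path e A x l p)) => x.
  have [xA|xA] := boolP (x \in A); last by exists [::].
  have [->|xl] := eqVneq x l; first by exists [::].
  by have [q Hq] := HC bA xA lA xl; exists q.
have [q Hq] : {q : T -> seq T & forall y, y \notin A -> y != l' -> ham_path e (~: A) l' y (q y)}.
  apply: (choice (P := fun y p => y \notin A -> y != l' -> ham_path e (~: A) l' y p)) => y.
  have [yA|yA] := boolP (y \in A); first by exists [::].
  have [->|yl] := eqVneq y l'; first by exists [::].
  have l'y : l' != y by rewrite eq_sym.
  have [||q Hq] := HC bA' _ _ l'y; rewrite ?inE //.
  by exists q.
exists (fun x => if x \in A then lab r x (p x) (+) r l l' (+) k else lab r l' (q x)).
move=> x y xA xl yA yl exy; rewrite xA (negbTE yA).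
have dis : [disjoint A & ~: A] by rewrite disjoints_subset finset.setCK.
have Px := Hp x xA xl; have Qy := Hq y yA yl.
have H := ham_cat dis Px Qy ell'; rewrite finset.setUCr in H.
have [_ lst _ _] := H.
have := rk x (p x ++ l' :: q y); rewrite lst => /(_ H); rewrite e_sym => /(_ exy) <-.
case: Px => _ lx _ _.
rewrite lab_cat lx (r_sym y x).
by case: (lab r x _) (r l l') (lab r l' _) (r x y) => [] [] [] [].
Qed.

Lemma near_sub M A s : size s <= 8 -> (forall x, x \in M -> x \notin s -> x \in A) -> nearly M A.
Proof. by move=> ss H; exists s. Qed.

(** Move v across and take the potential f of the new splitting. As r vanishes on the old cross
    edges, f is constant away from v, so r x v depends on v only, say as h v. Symmetry of r makes h
    constant along edges of M, hence constant. *)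
Lemma side_const r k M l l' : symmetric r -> ham_parity r k ->
  (forall A, nearly M A -> big A) -> (forall A, nearly (~: M) A -> big A) ->
  l \in M -> l' \notin M -> e l l' ->
  (forall x y, x \in M -> x != l -> y \notin M -> y != l' -> e x y -> r x y = false) ->
  exists c : bool, forall x y, x \in M -> x != l -> y \in M -> y != l -> e x y -> r x y = c.
Proof.
move=> r_sym rk bM bM' lM lM' ell' r0.
have Hv v : exists h : bool, v \in M -> v != l -> forall x, x \in M -> x != l -> e x v -> r x v = h.
  have [vM|] := boolP (v \in M); last by exists false.
  have [->|vl] := eqVneq v l; first by exists false.
  have [||||//|f Hf] := @cross_potential r k (M :\ v) l l' r_sym rk.
  - apply: bM; apply: (@near_sub _ _ [:: v]) => // x xM.
    by rewrite !inE xM andbT.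
  - apply: bM'; apply: (@near_sub _ _ [::]) => // x.
    by rewrite !inE => /negbTE->; rewrite andbF.
  - by rewrite !inE eq_sym vl.
  - by rewrite !inE (negbTE lM') andbF.
  have bA : big (M :\: [set v; l]).
    apply: bM; apply: (@near_sub _ _ [:: v; l]) => // x xM.
    by rewrite !inE xM andbT.
  have bB : big (~: M :\ l').
    apply: bM'; apply: (@near_sub _ _ [:: l']) => // x xM.
    by rewrite !inE in xM *; rewrite xM andbT.
  have con : forall x y, x \in M :\: [set v; l] -> y \in ~: M :\ l' -> e x y -> f x = f y.
    move=> x y; rewrite !inE negb_or => /andP[/andP[xv xl] xM] /andP[yl yM] exy.
    have := Hf x y; rewrite !inE xv xM xl (negbTE yM) andbF yl => /(_ isT isT isT isT exy).
    by rewrite r0 //; case: (f x) (f y) => [] [].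
  have cst := CO bA bB con.
  have [x0 x0A _] := NB v bA.
  exists (f x0 (+) f v) => _ _ x xM xl exv.
  have xv : x != v by apply: contraTneq exv => ->; rewrite e_irr.
  have vl' : v != l' by apply: contraNneq lM' => <-.
  have -> : f x0 = f x.
    by apply: cst; rewrite inE ?x0A // !inE negb_or xv xl xM.
  by apply: Hf; rewrite // !inE ?xv ?xM // eqxx.
have [h Hh] := choice Hv.
have bMl : big (M :\ l).
  by apply: bM; apply: (@near_sub _ _ [:: l]) => // x xM; rewrite !inE xM andbT.
have con u v : u \in M :\ l -> v \in M :\ l -> e u v -> h u = h v.
  rewrite !inE => /andP[ul uM] /andP[vl vM] euv.
  by rewrite -(Hh v vM vl u) // r_sym (Hh u) // e_sym.
have cst := CO bMl bMl con.
have [x0 x0A _] := NB l bMl.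
exists (h x0) => x y xM xl yM yl exy.
by rewrite (Hh y) //; apply: cst; rewrite finset.setUid // !inE yl.
Qed.

Lemma bigL A : nearly L0 A -> big A. Proof. by left. Qed.
Lemma bigR A : nearly (~: L0) A -> big A. Proof. by right. Qed.

(** Subtracting the potential g makes r vanish on cross edges and constant on each side; what
    remains is to see that the two constants agree. *)
Lemma off_edge_affine r k l l' : symmetric r -> ham_parity r k -> l \in L0 -> l' \notin L0 -> e l l' ->
  exists (f : T -> bool) (c : bool), forall x y, x != l -> x != l' -> y != l -> y != l' ->
    e x y -> r x y = f x (+) f y (+) c.
Proof.
move=> r_sym rk lL lR ell'.
have b0 : big L0 by apply: bigL; exists [::].
have b1 : big (~: L0) by apply: bigR; exists [::].
have [g Hg] := cross_potential r_sym rk b0 b1 lL lR ell'.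
pose r1 u v := r u v (+) (g u (+) g v) (+) false.
have r1_sym : symmetric r1 by move=> u v; rewrite /r1 r_sym (addbC (g u)).
have r1k : ham_parity r1 k.
  move=> x p H E; rewrite lab_shift -(rk x p H E) /= /r1.
  by case: (lab r x p) (g x) (g (last x p)) (r (last x p) x) => [] [] [] [].
have r10 x y : x \in L0 -> x != l -> y \notin L0 -> y != l' -> e x y -> r1 x y = false.
  by move=> *; rewrite /r1 Hg //; case: (g x) (g y) => [] [].
have [cL HL] := side_const r1_sym r1k bigL bigR lL lR ell' r10.
have [|||||cR HR] := @side_const r1 k (~: L0) l' l r1_sym r1k bigR.
- by move=> A; rewrite finset.setCK; exact: bigL.
- by rewrite inE.
- by rewrite inE negbK.
- by rewrite e_sym.
- move=> x y; rewrite !inE negbK => xR xl yL yl exy.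
  by rewrite r1_sym r10 // e_sym.
have cLR : cL = cR.
  have [v vA _] : exists2 w, w \in L0 :\ l & e l w.
    by apply: NB; apply: bigL; apply: (@near_sub _ _ [:: l]) => // x xM; rewrite !inE xM andbT.
  have [w wB evw] : exists2 w, w \in ~: L0 :\ l' & e v w.
    apply: NB; apply: bigR; apply: (@near_sub _ _ [:: l']) => // x xM.
    by rewrite !inE in xM *; rewrite xM andbT.
  move: vA wB; rewrite !inE => /andP[vl vL] /andP[wl wR].
  have vw : v != w by apply: contraTneq vL => ->.
  have wl1 : w != l by apply: contraNneq wR => ->.
  have vl1 : v != l' by apply: contraTneq vL => ->.
  (* Exchange the ends of a cross edge vw. Edges from v into its old side and from w into its old
     side now cross, with labels cL and cR, and so does vw, with label 0; f is constant elsewhere,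
     so cL = cR. *)
  have [||||//|f Hf] := @cross_potential r1 k (w |: (L0 :\ v)) l l' r1_sym r1k.
  - apply: bigL; apply: (@near_sub _ _ [:: v]) => // x xM.
    by rewrite !inE xM andbT => ->; rewrite orbT.
  - apply: bigR; apply: (@near_sub _ _ [:: w]) => // x.
    by rewrite !inE => /negbTE-> /negbTE->; rewrite andbF.
  - by rewrite !inE (eq_sym l v) vl lL orbT.
  - by rewrite !inE (negbTE lR) andbF orbF eq_sym.
  have bA : big (L0 :\: [set v; l]).
    by apply: bigL; apply: (@near_sub _ _ [:: v; l]) => // x xM; rewrite !inE xM andbT.
  have bB : big (~: L0 :\: [set w; l']).
    apply: bigR; apply: (@near_sub _ _ [:: w; l']) => // x xM.
    by rewrite !inE in xM *; rewrite xM andbT.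
  have con : forall x y, x \in L0 :\: [set v; l] -> y \in ~: L0 :\: [set w; l'] -> e x y -> f x = f y.
    move=> x y; rewrite !inE !negb_or => /andP[/andP[xv xl] xM] /andP[/andP[yw yl] yM] exy.
    have := Hf x y; rewrite !inE xv xM xl (negbTE yM) andbF yl (negbTE yw) orbT => /(_ isT isT isT isT exy).
    by rewrite r10 //; case: (f x) (f y) => [] [].
  have cst := CO bA bB con.
  have [x xA evx] := NB v bA; have [y yB ewy] := NB w bB.
  have fxy : f x = f y by apply: cst; rewrite inE ?xA ?yB ?orbT.
  move: xA yB; rewrite !inE !negb_or => /andP[/andP[xv xl] xM] /andP[/andP[yw yl] yM].
  have E1 : cL = f x (+) f v.
    rewrite -(HL x v) ?Hf // ?inE ?xv ?xM ?orbT ?negb_or ?vw ?eqxx // 1?e_sym //.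
  have E2 : cR = f w (+) f y.
    by rewrite -(HR w y) ?Hf // !inE ?eqxx // (negbTE yw) (negbTE yM) andbF.
  have E3 : false = f w (+) f v.
    rewrite -(r10 v w) // r1_sym Hf // ?inE ?eqxx ?negb_or ?vw // e_sym //.
  by rewrite E1 E2 fxy; move: E3; case: (f w) (f v) (f y) => [] [] [].
(* The cut of [L0] cancels the constant exactly on the cross edges. *)
exists (fun x => g x (+) (cL && (x \in L0))), cL => x y xl xl' yl yl' exy.
have r1E c : r1 x y = c -> r x y = g x (+) g y (+) c.
  by move=> <-; rewrite /r1; case: (g x) (g y) (r x y) => [] [] [].
have [xL|xR] := boolP (x \in L0); have [yL|yR] := boolP (y \in L0).
- by rewrite (r1E _ (HL x y xL xl yL yl exy)); case: (g x) (g y) (cL) => [] [] [].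
- by rewrite (r1E _ (r10 x y xL xl yR yl' exy)); case: (g x) (g y) (cL) => [] [] [].
- rewrite (r1E false); last by rewrite r1_sym (r10 y x) // e_sym.
  by case: (g x) (g y) (cL) => [] [] [].
- rewrite (r1E cR); last by apply: HR; rewrite ?inE.
  by rewrite -cLR; case: (g x) (g y) (cL) => [] [] [].
Qed.

(* The Hamilton cycle is [l y ... a l' b ... z], with [y ... a] and [b ... z] near the
   two sides of the splitting. *)
Lemma four_spokes r k l l' y z a b : symmetric r -> ham_parity r k -> l != l' ->
  (forall u v, u != l -> u != l' -> v != l -> v != l' -> e u v -> r u v = false) ->
  uniq [:: l; l'; y; z; a; b] -> e l y -> e l z -> e l' a -> e l' b ->
  r l y (+) r l z (+) r l' a (+) r l' b = k.
Proof.
move=> r_sym rk ll' r0 un ely elz ela elb.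
move: un; rewrite /= !inE !negb_or andbT -!andbA.
case/and5P=> _ ly lz la /and5P[lb l'y l'z l'a] /and5P[l'b yz ya yb] /and3P[za zb ab].
pose U1 := (y |: (a |: L0)) :\: [set z; b; l; l'].
pose U2 := ~: U1 :\: [set l; l'].
have bU1 : big U1.
  apply: bigL; apply: (@near_sub _ _ [:: z; b; l; l']) => // x xL.
  by rewrite !inE xL !orbT andbT -!orbA.
have bU2 : big U2.
  apply: bigR; apply: (@near_sub _ _ [:: y; a; l; l']) => // x; rewrite !inE => /negbTE->.
  by rewrite !negb_or orbF => /and4P[/negbTE-> /negbTE-> -> ->]; rewrite !andbF.
have sw (u v : T) : u != v -> v != u by rewrite eq_sym.
have [||p1 H1] := HC bU1 _ _ ya.
- by rewrite !inE eqxx /= !negb_or yz yb (sw _ _ ly) (sw _ _ l'y).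
- by rewrite !inE eqxx orbT andbT !negb_or ab (sw _ _ za) (sw _ _ la) (sw _ _ l'a).
have [zU1 bU1'] : z \notin U1 /\ b \notin U1 by rewrite !inE !eqxx ?orbT.
have [||p2 H2] := HC bU2 _ _ (sw _ _ zb).
- by rewrite in_setD in_setC bU1' in_set2 negb_or (sw _ _ lb) (sw _ _ l'b).
- by rewrite in_setD in_setC zU1 in_set2 negb_or (sw _ _ lz) (sw _ _ l'z).
have [U1l U1l'] : l \notin U1 /\ l' \notin U1 by rewrite !inE !eqxx !orbT.
have [U2l U2l'] : l \notin U2 /\ l' \notin U2 by rewrite !inE !eqxx !orbT.
have single v : ham_path e [set v] v v [::].
  by split=> // u; rewrite !inE.
have dis0 : [disjoint [set l'] & U2] by rewrite disjoints1.
have P2 := ham_cat dis0 (single l') H2 elb.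
have dis1 : [disjoint U1 & [set l'] :|: U2].
  rewrite disjoint_sym disjoints_subset subUset sub1set inE U1l' /=.
  by apply/subsetP => x; rewrite in_setD !inE => /andP[_].
have e_al' : e a l' by rewrite e_sym.
have P1 := ham_cat dis1 H1 P2 e_al'.
have dis2 : [disjoint [set l] & U1 :|: ([set l'] :|: U2)].
  by rewrite disjoints1 !in_setU !negb_or U1l in_set1 ll' U2l.
have P := ham_cat dis2 (single l) P1 ely.
have cov : [set l] :|: (U1 :|: ([set l'] :|: U2)) = [set: T].
  have U2E x : (x \in U2) = ((x != l) && (x != l')) && (x \notin U1).
    by rewrite in_setD in_setC in_set2 negb_or.
  apply/setP => x; rewrite 3!in_setU U2E !in_set1 in_setT.
  by case: (x == l); case: (x == l'); case: (x \in U1).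
rewrite cov in P; have [_ lst _ _] := P.
have := rk l ([::] ++ y :: (p1 ++ l' :: ([::] ++ b :: p2))).
rewrite lst e_sym => /(_ P elz) <-.
rewrite /= lab_cat /=.
have U1s u : u \in U1 -> (u != l) && (u != l').
  by move=> uU; apply/andP; split; apply: contraTneq uU => ->.
have U2s u : u \in U2 -> (u != l) && (u != l').
  by move=> uU; apply/andP; split; apply: contraTneq uU => ->.
have lz0 (U : {set T}) x p c : (forall u, u \in U -> (u != l) && (u != l')) -> ham_path e U x c p -> lab r x p = false.
  move=> Us [pe _ _ mU]; apply: (lab_zero (U := fun u => (u != l) && (u != l')) _ pe).
    by move=> u v /andP[ul ul'] /andP[vl vl']; exact: r0.
  by move=> u; rewrite mU; exact: Us.
rewrite (lz0 _ _ _ _ U1s H1) (lz0 _ _ _ _ U2s H2).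
have [_ -> _ _] := H1.
rewrite (r_sym a) (r_sym z).
by case: (r l y) (r l z) (r l' a) (r l' b) => [] [] [] [].
Qed.

(** Uses the Hamilton cycle l l' b ... z; it determines the label of ll' itself, which the cycles of
    [four_spokes] avoid. *)
Lemma double_spokes r k l l' z b : symmetric r -> ham_parity r k -> l != l' ->
  (forall u v, u != l -> u != l' -> v != l -> v != l' -> e u v -> r u v = false) ->
  uniq [:: l; l'; z; b] -> e l l' -> e l z -> e l' b ->
  r l l' (+) r l z (+) r l' b = k.
Proof.
move=> r_sym rk ll' r0 un ell' elz elb.
move: un; rewrite /= !inE !negb_or andbT -!andbA.
case/and5P=> _ lz lb l'z /andP[l'b zb].
have sw (u v : T) : u != v -> v != u by rewrite eq_sym.
pose U := ~: [set l; l'].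
have bU : big U.
  apply: bigL; apply: (@near_sub _ _ [:: l; l']) => // x _.
  by rewrite !inE !negb_or.
have [||p H] := HC bU _ _ (sw _ _ zb).
- by rewrite !inE !negb_or (sw _ _ lb) (sw _ _ l'b).
- by rewrite !inE !negb_or (sw _ _ lz) (sw _ _ l'z).
have single v : ham_path e [set v] v v [::].
  by split=> // u; rewrite !inE.
have dis0 : [disjoint [set l'] & U] by rewrite disjoints1 !inE eqxx orbT.
have P2 := ham_cat dis0 (single l') H elb.
have dis2 : [disjoint [set l] & [set l'] :|: U].
  by rewrite disjoints1 !inE eqxx negb_or ll'.
have P := ham_cat dis2 (single l) P2 ell'.
have cov : [set l] :|: ([set l'] :|: U) = [set: T].
  apply/setP => x; rewrite !inE.
  by case: (x == l); case: (x == l').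
rewrite cov in P; have [_ lst _ _] := P.
have := rk l ([::] ++ l' :: ([::] ++ b :: p)).
rewrite lst e_sym => /(_ P elz) <- /=.
have -> : lab r b p = false.
  have [pe _ _ mU] := H; apply: (lab_zero (U := fun u => (u != l) && (u != l')) _ pe).
    by move=> u v /andP[ul ul'] /andP[vl vl']; exact: r0.
  by move=> u; rewrite mU !inE negb_or.
rewrite (r_sym z).
by case: (r l l') (r l z) (r l' b) => [] [] [].
Qed.

Lemma nbr_avoiding v s : size s <= 8 -> exists2 w, w \notin s & e v w.
Proof.
move=> ss; have [|w] := @NB v [set w | w \notin s]; last by rewrite inE; exists w.
by apply: bigL; apply: (near_sub ss) => x _; rewrite inE.
Qed.

(** Compare two instances of [four_spokes] that differ only in y, with z, a and b avoiding both
    choices. *)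
Lemma spokes_const r k l l' : symmetric r -> ham_parity r k -> l != l' ->
  (forall u v, u != l -> u != l' -> v != l -> v != l' -> e u v -> r u v = false) ->
  exists h : bool, forall y, y != l' -> e l y -> r l y = h.
Proof.
move=> r_sym rk ll' r0.
have [y0 + ely0] := @nbr_avoiding l [:: l; l'] isT.
rewrite !inE !negb_or => /andP[y0l y0l'].
exists (r l y0) => y yl' ely.
have yl : y != l by apply: contraTneq ely => ->; rewrite e_irr.
have [z + elz] := @nbr_avoiding l [:: l; l'; y; y0] isT.
rewrite !inE !negb_or => /and4P[zl zl' zy zy0].
have [a + ela] := @nbr_avoiding l' [:: l; l'; y; y0; z] isT.
rewrite !inE !negb_or => /and5P[al al' ay ay0 az].
have [b + elb] := @nbr_avoiding l' [:: l; l'; y; y0; z; a] isT.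
rewrite !inE !negb_or => /and5P[bl bl' bY by0 /andP[bz ba]].
have sw (u v : T) : u != v -> v != u by rewrite eq_sym.
have E x : e l x -> x != l -> x != l' -> z != x -> a != x -> b != x ->
    r l x (+) r l z (+) r l' a (+) r l' b = k.
  move=> elx xl xl' zx ax bx; apply: (four_spokes r_sym rk ll' r0) => //.
  rewrite /= !inE !negb_or ll' !andbT.
  by rewrite (sw _ _ xl) (sw _ _ zl) (sw _ _ al) (sw _ _ bl) (sw _ _ xl') (sw _ _ zl') (sw _ _ al')
    (sw _ _ bl') (sw _ _ zx) (sw _ _ ax) (sw _ _ bx) (sw _ _ az) (sw _ _ bz) (sw _ _ ba).
have := E y ely yl yl' zy ay bY; rewrite -(E y0 ely0 y0l y0l' zy0 ay0 by0).
by case: (r l y) (r l y0) (r l z) (r l' a) (r l' b) => [] [] [] [] [].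
Qed.

Lemma even_labelling_cut r : odd #|T| -> symmetric r -> ham_parity r false ->
  exists f : T -> bool, forall x y, e x y -> r x y = f x (+) f y.
Proof.
move=> oT r_sym rk.
have [l lL _] : exists2 l, l \in L0 & true.
  have /card_gt0P[x0 _] : 0 < #|T| by case: #|T| oT.
  have [|l lL _] := @NB x0 L0; last by exists l.
  by apply: bigL; exists [::].
have [l' + ell'] : exists2 l', l' \in ~: L0 & e l l'.
  by apply: NB; apply: bigR; exists [::].
rewrite inE => lR.
have ll' : l != l' by apply: contraTneq lL => ->.
have [f [c Hf]] := off_edge_affine r_sym rk lL lR ell'.
pose r2 u v := r u v (+) (f u (+) f v) (+) c.
have r2_sym : symmetric r2 by move=> u v; rewrite /r2 r_sym (addbC (f u)).
(* A Hamilton cycle has an odd number of edges, so the constant c enters its parity once. *)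
have r2k : ham_parity r2 c.
  move=> x p H E; rewrite lab_shift.
  have [_ _ un mT] := H.
  have : odd (size p) = false.
    have : size (x :: p) = #|T| by rewrite -(card_uniqP un); apply: eq_card => z; rewrite mT inE.
    by move=> /= Es; move: oT; rewrite -Es /= => /negbTE.
  move=> ->; rewrite andbF /r2; have := rk x p H E.
  by case: (lab r x p) (f x) (f (last x p)) (r (last x p) x) c {Hf r2 r2_sym} => [] [] [] [] [].
have r20 u v : u != l -> u != l' -> v != l -> v != l' -> e u v -> r2 u v = false.
  by move=> *; rewrite /r2 Hf //; case: (f u) (f v) c {Hf r2 r2_sym r2k} => [] [] [].
have [h Hh] := spokes_const r2_sym r2k ll' r20.
have l'l : l' != l by rewrite eq_sym.
have r20' u v : u != l' -> u != l -> v != l' -> v != l -> e u v -> r2 u v = false.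
  by move=> *; apply: r20.
have [h' Hh'] := spokes_const r2_sym r2k l'l r20'.
have [y + ely] := @nbr_avoiding l [:: l; l'] isT.
rewrite !inE !negb_or => /andP[yl yl'].
have [z + elz] := @nbr_avoiding l [:: l; l'; y] isT.
rewrite !inE !negb_or => /and3P[zl zl' zy].
have [a + ela] := @nbr_avoiding l' [:: l; l'; y; z] isT.
rewrite !inE !negb_or => /and4P[al al' ay az].
have [b + elb] := @nbr_avoiding l' [:: l; l'; y; z; a] isT.
rewrite !inE !negb_or => /and5P[bl bl' bY bz ba].
have sw (u v : T) : u != v -> v != u by rewrite eq_sym.
(* By [four_spokes], c = h + h + h' + h'. *)
have c0 : c = false.
  rewrite -(four_spokes r2_sym r2k ll' r20 _ ely elz ela elb).
    by rewrite (Hh y) // (Hh z) // (Hh' a) // (Hh' b) //; case: (h); case: (h').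
  rewrite /= !inE !negb_or ll' !andbT.
  by rewrite (sw _ _ yl) (sw _ _ zl) (sw _ _ al) (sw _ _ bl) (sw _ _ yl') (sw _ _ zl') (sw _ _ al')
    (sw _ _ bl') (sw _ _ zy) (sw _ _ ay) (sw _ _ bY) (sw _ _ az) (sw _ _ bz) (sw _ _ ba).
have Ell' : r2 l l' = h (+) h'.
  have un : uniq [:: l; l'; z; b].
    rewrite /= !inE !negb_or ll' !andbT.
    by rewrite (sw _ _ zl) (sw _ _ bl) (sw _ _ zl') (sw _ _ bl') (sw _ _ bz).
  have := double_spokes r2_sym r2k ll' r20 un ell' elz elb.
  rewrite (Hh z) // (Hh' b) // c0.
  by case: (r2 l l'); case: (h); case: (h').
(* With c = 0 only the edges at l and l' can carry a label: h and h', and h + h' on ll'. This is a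
   cut. *)
pose g x := if x == l then h else if x == l' then h' else false.
exists (fun x => f x (+) g x) => x y' exy.
suff E2 : r2 x y' = g x (+) g y'.
  have : r x y' = r2 x y' (+) (f x (+) f y') (+) c.
    by rewrite /r2; case: (r x y') (f x) (f y') (c) => [] [] [] [].
  by rewrite E2 c0 => ->; case: (g x) (g y') (f x) (f y') => [] [] [] [].
rewrite /g.
have [xl|xl] := eqVneq x l; have [y'l|y'l] := eqVneq y' l.
- by move: exy; rewrite xl y'l e_irr.
- rewrite xl in exy *; have [->//|y'l'] := eqVneq y' l'.
  by rewrite (Hh y') // addbF.
- rewrite y'l in exy *; rewrite r2_sym; have [->|xl'] := eqVneq x l'; first by rewrite addbC.
  by rewrite (Hh x) // e_sym.
have [xl'|xl'] := eqVneq x l'; have [y'l'|y'l'] := eqVneq y' l'.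
- by move: exy; rewrite xl' y'l' e_irr.
- by rewrite xl' in exy *; rewrite (Hh' y') // addbF.
- by rewrite y'l' in exy *; rewrite r2_sym (Hh' x) // e_sym.
- by rewrite r20.
Qed.

End Parity.

(** * Duality in the edge space *)

Section LinearAlgebra.
Variables (T : finType) (e : rel T).
Hypotheses (e_sym : symmetric e) (e_irr : irreflexive e).

Lemma F2_neq0D (u v : 'F_2) : (u + v != 0) = (u != 0) (+) (v != 0).
Proof. by case: u v => [[|[|u]] Hu] [[|[|v]] Hv]. Qed.

Lemma cycle_sum_lab (F : T -> T -> 'F_2) (x0 y : T) (p : seq T) :
  (\sum_(i < (size p).+1) F (nth x0 (y :: p) i) (nth x0 p i) != 0) =
  lab (fun u v => F u v != 0) y p (+) (F (last y p) x0 != 0).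
Proof.
elim: p y => [|z p IH] y /=; first by rewrite big_ord_recl big_ord0 addr0.
by rewrite big_ord_recl F2_neq0D /= IH addbA.
Qed.

Lemma next_cons_nth (x : T) (p : seq T) (i : nat) : uniq (x :: p) -> (i <= size p)%N ->
  next (x :: p) (nth x (x :: p) i) = nth x p i.
Proof.
move=> un ip; rewrite next_nth mem_nth //.
by rewrite -[LHS]/(nth x p (index (nth x (x :: p) i) (x :: p))) index_uniq.
Qed.

(** Distinct u and v with the same pair would be successors of each other, which closes the cycle
    after two steps. *)
Lemma next_pair_inj (c : seq T) : uniq c -> (2 < size c)%N ->
  {in c &, injective (fun x => [set x; next c x])}.
Proof.
case: c => [|x0 p] // un sz u v uc vc /= E.
have nn x : x \in x0 :: p -> next (x0 :: p) (next (x0 :: p) x) != x.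
  move=> xc; have xi : (index x (x0 :: p) <= size p)%N by rewrite -ltnS -[(size p).+1]/(size (x0 :: p)) index_mem.
  rewrite -{1}(nth_index x0 xc) next_cons_nth //.
  move: xi; rewrite leq_eqVlt => /orP[/eqP xi|xi].
    rewrite xi nth_default // -[x0 in next _ x0]/(nth x0 (x0 :: p) 0) next_cons_nth //.
    apply/eqP => Ex; move: xi; rewrite -Ex.
    have := index_uniq x0 (_ : (1 < size (x0 :: p))%N) un; rewrite /= -/(index _ (x0 :: p)).
    by move=> -> //; move: sz => /=; lia.
  rewrite -[nth x0 p _]/(nth x0 (x0 :: p) (index x (x0 :: p)).+1) next_cons_nth //.
  apply/eqP => Ex; have := congr1 (index^~ (x0 :: p)) Ex.
  move: xi; rewrite leq_eqVlt => /orP[/eqP xi|xi].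
    rewrite xi nth_default // => Ei; move: xi; rewrite -Ei /= eqxx.
    by move: sz => /= + p1; rewrite -p1.
  rewrite -[nth x0 p _]/(nth x0 (x0 :: p) (index x (x0 :: p)).+2) index_uniq //.
  by lia.
have [//|uv] := eqVneq u v.
have : u \in [set v; next (x0 :: p) v] by rewrite -E !inE eqxx.
rewrite !inE (negbTE uv) orFb => /eqP Eu.
have : v \in [set u; next (x0 :: p) u] by rewrite E !inE eqxx.
rewrite !inE eq_sym (negbTE uv) orFb => /eqP Ev.
by have := nn v vc; rewrite -Eu -Ev eqxx.
Qed.

Lemma lab_cut (r : T -> T -> bool) (f : T -> bool) x p :
  (forall u v, e u v -> r u v = f u (+) f v) -> path e x p ->
  lab r x p = f x (+) f (last x p).
Proof.
move=> H; elim: p x => [|y p IH] x /=; first by rewrite addbb.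
case/andP=> exy /IH->; rewrite H //.
by case: (f x) (f y) (f (last y p)) => [] [] [].
Qed.

Lemma cycle_edges_sub k (c : k.-tuple T) : ucycleb e c -> cycle_edges c \subset edge_set e.
Proof.
case/andP=> cc _; apply/subsetP => S /imsetP[x xc ->].
rewrite inE; apply/existsP; exists x; apply/existsP; exists (next c x).
by rewrite eqxx andbT; apply: next_cycle.
Qed.

(** The identity minus a projection onto W kills W but not v. A coordinate that is nonzero at v,
    expanded over single edges, is the required weight. *)
Lemma edge_functional (W : {vspace edge_space e}) (v : edge_space e) : v \notin W ->
  exists w : edge_type e -> 'F_2,
    (forall u : edge_space e, u \in W -> \sum_f u f * w f = 0) /\ \sum_f v f * w f != 0.
Proof.
move=> vW; pose g := (\1 - projv W)%VF.
have gv : g v != 0.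
  apply: contra vW; rewrite add_lfunE opp_lfunE id_lfunE subr_eq0 => /eqP E.
  by rewrite E memv_proj.
have [f0 gf0] : exists f0, (g v : {ffun _ -> _}) f0 != 0.
  apply/existsP; apply: contraNT gv; rewrite negb_exists => /forallP H.
  by apply/eqP/ffunP => f; rewrite ffunE; apply/eqP; have := H f; rewrite negbK.
pose d f : edge_space e := [ffun f' => (f' == f)%:R].
have ex (u : edge_space e) : u = \sum_f u f *: d f.
  apply/ffunP => f; rewrite sum_ffunE (bigD1 f) //= big1 => [|f' /negbTE f'f].
    by rewrite !ffunE eqxx addr0; exact: (esym (mulr1 (u f : 'F_2))).
  by rewrite !ffunE eq_sym f'f; exact: (mulr0 (u f' : 'F_2)).
have gE (u : edge_space e) : (g u : {ffun _ -> _}) f0 = \sum_f u f * (g (d f) : {ffun _ -> _}) f0.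
  rewrite {1}(ex u) linear_sum sum_ffunE; apply: eq_bigr => f _.
  by rewrite linearZ ffunE.
exists (fun f => (g (d f) : {ffun _ -> _}) f0); split=> [u uW|]; last by rewrite -gE.
by rewrite -gE add_lfunE opp_lfunE id_lfunE projv_id // subrr ffunE.
Qed.

(** For a cycle outside the span, some edge weight vanishes on all Hamilton cycles but not on it.
    The support of the weight is even on Hamilton cycles, hence a cut, and every cycle meets a cut
    evenly. *)
Lemma cycle_space_spanned : (2 < #|T|)%N ->
  (forall r, symmetric r -> ham_parity e r false ->
    exists f : T -> bool, forall x y, e x y -> r x y = f x (+) f y) ->
  cycle_space_k e #|T| = cycle_space e.
Proof.
move=> T2 H; apply/eqP; rewrite eqEsubv; apply/andP; split.
  apply: sub_span => v /mapP[F]; rewrite mem_enum => FT ->; apply: map_f.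
  by rewrite mem_enum; apply/bigcupP; exists ord_max.
apply/span_subvP => v /mapP[F]; rewrite mem_enum => /bigcupP[k _ /imsetP[c + ->]] ->.
rewrite inE => /andP[k2 uc].
apply: contraT => vW; have [w [wW wv]] := edge_functional vW.
(* The weight is extended by 0 beyond the edges, so that it labels all pairs of vertices. *)
pose w' (S : {set T}) : 'F_2 := if insub S is Some f then w f else 0.
have wsum k' (c' : k'.-tuple T) : (2 < k')%N -> ucycleb e c' ->
    \sum_f edge_vector e (cycle_edges c') f * w f = \sum_(x in c') w' [set x; next c' x].
  move=> k2' uc'; have /andP[_ un] := uc'.
  have inj := next_pair_inj un; rewrite size_tuple in inj.
  rewrite -(big_imset w' (inj k2')) /= -/(cycle_edges c').
  rewrite (bigID (fun S => S \in edge_set e)) /= [X in _ = _ + X]big1 ?addr0; last first.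
    by move=> S /andP[Sc]; rewrite (subsetP (cycle_edges_sub uc')).
  transitivity (\sum_(f : edge_type e | val f \in cycle_edges c') w f).
    rewrite [RHS]big_mkcond; apply: eq_bigr => f _; rewrite ffunE.
    by case: (_ \in _); rewrite ?mul1r ?mul0r.
  rewrite (reindex_omap (val : edge_type e -> {set T}) insub) /=; last first.
    by move=> S /andP[_ SE]; rewrite insubT.
  apply: eq_big => [f|f fc]; last by rewrite /w' valK.
  by rewrite valK eqxx andbT (valP f) andbT.
pose r x y := w' [set x; y] != 0.
have wlab k' (c' : k'.-tuple T) x p : val c' = x :: p -> (2 < k')%N -> ucycleb e c' ->
    (\sum_f edge_vector e (cycle_edges c') f * w f != 0) =
    lab r x p (+) r (last x p) x.
  move=> Ec k2' uc'; have /andP[_ un] := uc'.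
  rewrite wsum // -cycle_sum_lab; congr (_ != _).
  rewrite -big_uniq //= Ec (big_nth x) big_mkord; apply: eq_bigr => i _.
  by rewrite next_cons_nth // -?Ec // -ltnS.
have r_sym : symmetric r by move=> x y; rewrite /r finset.setUC.
have [|f Hf] := H r r_sym.
  move=> x p [pp _ un mT] el.
  have sz : size (x :: p) == #|T|.
    by rewrite -(card_uniqP un); apply/eqP/eq_card => z; rewrite mT inE.
  pose c' := Tuple sz.
  have uc' : ucycleb e c' by rewrite /ucycleb /= rcons_path pp el.
  apply/negbTE; rewrite -(wlab _ c' x p) // negbK; apply/eqP; apply: wW.
  apply: memv_span; apply: map_f; rewrite mem_enum.
  by apply/imsetP; exists c'; rewrite // inE T2.
case Ec : (val c) => [|x p].
  by have := size_tuple c; rewrite -[size c]/(size (val c)) Ec => E; move: k2; rewrite -E.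
have := wv; rewrite (wlab _ c x p) // (lab_cut Hf); last first.
  by move: uc; rewrite /ucycleb Ec /= rcons_path => /andP[/andP[]].
rewrite Hf; last by move: uc; rewrite /ucycleb Ec /= rcons_path => /andP[/andP[]].
by case: (f x) (f (last x p)) => [] [].
Qed.

End LinearAlgebra.

(** * Expansion in jumbled graphs *)

Section Jumbled.
Variables (R : realType) (T : finType) (e : rel T) (p beta : R) (d m : nat).
Hypotheses (e_sym : symmetric e) (e_irr : irreflexive e) (p0 : 0 < p).
Hypothesis sparse : forall U : {set T},
  (edges_in e U)%:R <= p * 'C(#|U|, 2)%:R + beta * #|U|%:R.
Hypothesis beta0 : 0 <= beta.
Hypothesis d_large : 121 * p * m%:R + 22 * beta < d%:R.
Hypothesis m0 : (0 < m)%N.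

Definition degin (A : {set T}) (v : T) : nat := #|[set w in A | e v w]|.

Lemma edges_in_ge (S W : {set T}) : S \subset W ->
  (forall v, v \in S -> d <= degin W v)%N -> (d * #|S| <= 2 * edges_in e W)%N.
Proof.
move=> SW H.
pose P := [set z : T * T | [&& z.1 \in W, z.2 \in S & e z.2 z.1]].
have : (d * #|S| <= 1 * #|P|)%N.
  apply: card_pairs_ge => y yS; rewrite mul1n; apply: leq_trans (H y yS) _.
  by apply/subset_leq_card/subsetP => x; rewrite !inE /= yS => /andP[-> ->].
rewrite mul1n => /leq_trans; apply.
have : P \subset \bigcup_(f in [set f in edge_set e | f \subset W])
    [set z : T * T | (f == [set z.1; z.2]) && (z.1 != z.2)].
  apply/subsetP => -[x y]; rewrite inE /= => /and3P[xW yS eyx].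
  apply/bigcupP; exists [set x; y]; rewrite !inE /= ?eqxx /=.
    rewrite subUset !sub1set xW (subsetP SW) // !andbT.
    by apply/existsP; exists x; apply/existsP; exists y; rewrite e_sym eyx eqxx.
  by apply: contraTneq eyx => ->; rewrite e_irr.
move/subset_leq_card/leq_trans; apply; apply: card_bigcup_le => f _.
have [->|[[x y] xy]] := set_0Vmem [set z : T * T | (f == [set z.1; z.2]) && (z.1 != z.2)].
  by rewrite cards0.
apply: (@leq_trans #|[set (x, y); (y, x)]|); last by rewrite cards2; case: (_ != _).
apply/subset_leq_card/subsetP => -[u v]; move: xy; rewrite !inE /= => /andP[/eqP-> xy] /andP[/eqP E uv].
have Hu : u \in [set x; y] by rewrite E !inE eqxx.
have Hv : v \in [set x; y] by rewrite E !inE eqxx orbT.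
move: Hu Hv uv; rewrite !inE => /orP[]/eqP-> /orP[]/eqP->; by rewrite ?eqxx ?orbT.
Qed.

Lemma edges_in_le (W : {set T}) :
  2 * (edges_in e W)%:R <= p * #|W|%:R ^+ 2 + 2 * beta * #|W|%:R.
Proof.
have C2 : ('C(#|W|, 2)%:R : R) * 2 <= #|W|%:R ^+ 2.
  rewrite -natrX -natrM ler_nat bin2 muln2 halfK.
  by rewrite (leq_trans (leq_subr _ _)) // expnS expn1 leq_mul2l leq_pred orbT.
have := sparse W; rewrite -(ler_pM2l p0) in C2; lra.
Qed.

(** Divide d |S| <= 2 e(S) <= p |S|^2 + 2 beta |S| by |S|. *)
Lemma dense_large (S : {set T}) : S != finset.set0 ->
  (forall v, v \in S -> d <= degin S v)%N -> d%:R <= p * #|S|%:R + 2 * beta.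
Proof.
rewrite -card_gt0 => S0 H.
have := edges_in_ge (subxx S) H; rewrite -(ler_nat R) !natrM => H1.
have := le_trans H1 (edges_in_le S).
have S0' : 0 < #|S|%:R :> R by rewrite ltr0n.
have -> : p * #|S|%:R ^+ 2 + 2 * beta * #|S|%:R = (p * #|S|%:R + 2 * beta) * #|S|%:R.
  by ring.
by rewrite ler_pM2r.
Qed.

Lemma dense_large_nat (S : {set T}) : S != finset.set0 ->
  (forall v, v \in S -> d <= degin S v)%N -> (121 * m <= #|S|)%N.
Proof.
move=> S0 H; have D := dense_large S0 H.
rewrite leqNgt; apply/negP => lt.
have : #|S|%:R <= 121 * m%:R :> R by rewrite -natrM ler_nat ltnW.
rewrite -(ler_pM2l p0) => H1.
have := d_large; have := beta0; lra.
Qed.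

(* Here 121 is the square of 11: if [S] had fewer than [10 * #|S|] neighbours in [U],
   then [S] and these would span too many edges for their size. *)
Lemma small_expand (U S : {set T}) : (forall v, v \in U -> d <= degin U v)%N -> S \subset U ->
  (0 < #|S| <= m)%N -> (10 * #|S| <= #|[set y in U | (y \notin S) && [exists x in S, e x y]]|)%N.
Proof.
move=> HU SU /andP[S0 Sm]; rewrite leqNgt; apply/negP => lt.
set N := [set y in U | _] in lt.
have NSc : (#|S :|: N| <= 11 * #|S|)%N.
  apply: leq_trans (leq_of_leqif (leq_card_setU _ _)) _; lia.
have H : (d * #|S| <= 2 * edges_in e (S :|: N))%N.
  apply: edges_in_ge; first exact: finset.subsetUl.
  move=> v vS; apply: leq_trans (HU v (subsetP SU _ vS)) _.
  apply/subset_leq_card/subsetP => w; rewrite !inE => /andP[wU evw].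
  rewrite evw wU andbT /=; case: (w \in S) => //=.
  by apply/exists_inP; exists v.
have := edges_in_le (S :|: N); move: H; rewrite -(ler_nat R) !natrM => H1 H2.
have := le_trans H1 H2 => {H1 H2}.
have S0' : 0 < #|S|%:R :> R by rewrite ltr0n.
have Sm' : #|S|%:R <= m%:R :> R by rewrite ler_nat.
have W0 : 0 <= #|S :|: N|%:R :> R by [].
have W1 : #|S :|: N|%:R <= 11 * #|S|%:R :> R by rewrite -natrM ler_nat.
have W2 : #|S :|: N|%:R ^+ 2 <= 121 * #|S|%:R ^+ 2 :> R.
  have -> : 121 * #|S|%:R ^+ 2 = (11 * #|S|%:R) ^+ 2 :> R by ring.
  by rewrite lerXn2r ?nnegrE // mulr_ge0.
set s : R := #|S|%:R in S0' Sm' W1 W2 *; set w : R := #|S :|: N|%:R in W0 W1 W2 *.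
apply/negP; rewrite -ltNge.
have E1 : p * w ^+ 2 <= p * (121 * s ^+ 2) by rewrite ler_pM2l.
have E2 : 2 * beta * w <= 2 * beta * (11 * s) by rewrite ler_wpM2l // mulr_ge0.
have E3 : (121 * p * m%:R + 22 * beta) * s < d%:R * s by rewrite ltr_pM2r.
have E4 : 121 * p * s * s <= 121 * p * m%:R * s.
  by rewrite ler_pM2r // ler_wpM2l // mulr_ge0 // ltW.
nra.
Qed.

End Jumbled.

(** * Sets into which all degrees are large *)

Section Rich.
Local Open Scope nat_scope.
Variables (R : realType) (T : finType) (e : rel T) (p beta : R) (d m N0 t j q : nat).
Hypotheses (e_sym : symmetric e) (e_irr : irreflexive e) (p0 : (0 < p)%R).
Hypothesis sparse : forall U : {set T},
  ((edges_in e U)%:R <= p * 'C(#|U|, 2)%:R + beta * #|U|%:R)%R.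
Hypothesis beta0 : (0 <= beta)%R.
Hypothesis d_large : (121 * p * m%:R + 22 * beta < d%:R)%R.
Hypothesis d_N0 : (p * N0%:R + 2 * beta <= d%:R)%R.
Hypothesis m0 : (0 < m)%N.
Hypothesis eJ : joined e m.
Hypotheses (Ht : m <= 2 ^ t) (Hj : j <= 3 * (t + 2)) (HK : 48 * (2 * t + 4) * q <= N0)
  (HC : 2 * j + 6 + 13 * m <= j * q) (HN : 32 * m * 64 ^ j < N0).

Definition rich (A : {set T}) := forall v, d <= degin e A v.

Lemma val_set_card (U : {set T}) (S : {set {x : T | x \in U}}) : #|val @: S| = #|S|.
Proof. by rewrite card_imset //; apply: val_inj. Qed.

Lemma val_set_sub (U : {set T}) (S : {set {x : T | x \in U}}) : val @: S \subset U.
Proof. by apply/subsetP => x /imsetP[y _ ->]; exact: valP. Qed.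

(** Inner degree d forces both |U| >= N0 and the expansion of small sets, so [hamilton_connected]
    applies to the subgraph induced on the subtype of U. *)
Lemma rich_ham (U : {set T}) x y : (forall v, v \in U -> d <= degin e U v) ->
  x \in U -> y \in U -> x != y -> exists s, ham_path e U x y s.
Proof.
move=> HU xU yU xy.
have U0 : U != finset.set0 by apply/set0Pn; exists x.
have Um := dense_large_nat e_sym e_irr p0 sparse beta0 d_large U0 HU.
have UN : N0 <= #|U|.
  have := dense_large e_sym e_irr p0 sparse U0 HU => H.
  have : (p * N0%:R <= p * #|U|%:R)%R by rewrite -(lerD2r (2 * beta)%R) (le_trans d_N0).
  by rewrite ler_pM2l // ler_nat.
pose T' := {x : T | x \in U} : finType.
pose e' : rel T' := fun u v => e (val u) (val v).
have cT' : #|T'| = #|U| by rewrite card_sig; apply: eq_card => z; rewrite !inE.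
have eE' : expands e' m.
  move=> S Sm; have := small_expand e_sym e_irr p0 sparse beta0 d_large m0 HU (val_set_sub S).
  rewrite val_set_card Sm => /(_ isT) /leq_trans; apply.
  rewrite -(val_set_card (nbh e' S)); apply/subset_leq_card/subsetP => z.
  rewrite inE => /and3P[zU zS /exists_inP[v /imsetP[v' v'S ->] ev]].
  apply/imsetP; exists (Sub z zU); rewrite ?SubK // inE; apply/andP; split.
    by apply: contra zS => zS; apply/imsetP; exists (Sub z zU); rewrite ?SubK.
  by apply/exists_inP; exists v'; rewrite // /e' SubK.
have eJ' : joined e' m.
  move=> A B dis Am Bm.
  have dis' : [disjoint val @: A & val @: B].
    rewrite disjoints_subset; apply/subsetP => z /imsetP[u uA ->]; rewrite inE.
    apply/negP => /imsetP[v vB /val_inj uv].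
    by move: dis; rewrite disjoints_subset => /subsetP/(_ u uA); rewrite inE uv vB.
  have [||u [v [/imsetP[u' uA ->] /imsetP[v' vB ->] euv]]] := eJ dis'; rewrite ?val_set_card //.
  by exists u', v'.
have e'_sym : symmetric e' by move=> u v; exact: e_sym.
have e'_irr : irreflexive e' by move=> u; exact: e_irr.
have n1 : 4 * (m + 2) <= #|T'| by rewrite cT'; lia.
have n2 : 48 * (2 * t + 4) * q <= #|T'| by rewrite cT'; exact: leq_trans UN.
have n3 : 32 * m * 64 ^ j < #|T'| by rewrite cT'; exact: leq_trans UN.
have [x' vx] : exists x' : T', val x' = x by exists (Sub x xU); rewrite SubK.
have [y' vy] : exists y' : T', val y' = y by exists (Sub y yU); rewrite SubK.
have xy' : x' != y' by rewrite -val_eqE vx vy.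
have [s [ps ls us ms]] := hamilton_connected e'_sym e'_irr eE' eJ' m0 n1 Ht Hj n2 HC n3 xy'.
exists (map val s); split.
- by rewrite -vx path_map.
- by rewrite -vx last_map ls.
- by rewrite -vx -map_cons map_inj_uniq //; exact: val_inj.
- move=> z; rewrite -vx -map_cons; apply/mapP/idP => [[w _ ->]|zU]; first exact: valP.
  by exists (Sub z zU); rewrite ?SubK // ms inE.
Qed.

(** A vertex of A shares its colour with its neighbours in B, and conversely; so a nonempty colour
    class has inner degree at least d and at least 121 m vertices. Were both classes nonempty, sizes
    would force m vertices of one colour in A and m of the other in B, and these are joined. *)
Lemma rich_connected (A B : {set T}) (f : T -> bool) : rich A -> rich B ->
  (forall x y, x \in A -> y \in B -> e x y -> f x = f y) ->
  forall x y, x \in A :|: B -> y \in A :|: B -> f x = f y.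
Proof.
move=> rA rB Hf x y xAB yAB; apply/eqP; apply: contraT => fxy.
pose X c := [set v in A :|: B | f v == c].
have Xm c : X c != finset.set0 -> 121 * m <= #|X c|.
  move=> X0; apply: (dense_large_nat e_sym e_irr p0 sparse beta0 d_large X0) => v.
  rewrite 2!inE => /andP[/orP[vA|vB] fv].
    apply: leq_trans (rB v) _; apply/subset_leq_card/subsetP => w.
    rewrite !inE => /andP[wB evw]; rewrite wB evw orbT /= andbT.
    by rewrite -(Hf v w).
  apply: leq_trans (rA v) _; apply/subset_leq_card/subsetP => w.
  rewrite !inE => /andP[wA evw]; rewrite wA evw /= andbT.
  by rewrite (Hf w v) // e_sym.
have large (C : {set T}) : rich C -> 2 * m <= #|C|.
  move=> rC; have C0 : C != finset.set0.
    apply/set0Pn; have : 0 < degin e C x.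
      have dp : 0 < d.
        rewrite -(ltr_nat R); apply: le_lt_trans d_large.
        by rewrite addr_ge0 // mulr_ge0 // mulr_ge0 // ltW.
      exact: leq_trans dp (rC x).
    by rewrite card_gt0 => /set0Pn[w]; rewrite inE => /andP[wC _]; exists w.
  have := dense_large_nat e_sym e_irr p0 sparse beta0 d_large C0 (fun v _ => rC v); lia.
have Xx c : X c != finset.set0.
  apply/set0Pn; have [<-|fxc] := eqVneq (f x) c; first by exists x; rewrite inE xAB eqxx.
  exists y; rewrite inE yAB /=; move: fxc fxy; by case: c (f x) (f y) => [] [] [].
have noJ c c' : c != c' -> m <= #|X c :&: A| -> m <= #|X c' :&: B| -> False.
  move=> cc' h1 h2; have dis : [disjoint X c :&: A & X c' :&: B].
    rewrite disjoints_subset; apply/subsetP => z; rewrite !inE => /andP[/andP[_ /eqP->] _].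
    by rewrite (negbTE cc') andbF.
  have [u [v []]] := eJ dis h1 h2.
  rewrite !inE => /andP[/andP[_ /eqP fu] uA] /andP[/andP[_ /eqP fv] vB] euv.
  by move: cc'; rewrite -fu -fv (Hf u v) ?eqxx.
have split_card c : #|X c| <= #|X c :&: A| + #|X c :&: B|.
  apply: leq_trans (leq_of_leqif (leq_card_setU _ _)); apply/subset_leq_card/subsetP => z.
  by rewrite !inE => /andP[/orP[]-> ->]; rewrite ?orbT.
have all_card (C : {set T}) : C \subset A :|: B -> #|C| <= #|X true :&: C| + #|X false :&: C|.
  move=> CAB; apply: leq_trans (leq_of_leqif (leq_card_setU _ _)); apply/subset_leq_card/subsetP => z zC.
  rewrite in_setU !in_setI zC !andbT !inE; have := subsetP CAB z zC; rewrite inE => ->.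
  by case: (f z).
have c1 := all_card A (finset.subsetUl _ _); have c2 := all_card B (finset.subsetUr _ _).
have l1 := large A rA; have l2 := large B rB.
have s1 := split_card true; have s2 := split_card false.
have x1 := Xm true (Xx true); have x2 := Xm false (Xx false).
have n1 := noJ true false isT; have n2 := noJ false true isT.
clear - c1 c2 l1 l2 s1 s2 x1 x2 n1 n2 m0.
have [h1|h1] := leqP m #|X true :&: A|; have [h2|h2] := leqP m #|X false :&: B|.
- by case: (n1 h1 h2).
- by have [h3|h3] := leqP m #|X false :&: A|; have [h4|h4] := leqP m #|X true :&: B|;
    solve [lia | case: (n2 h3 h4)].
- by have [h3|h3] := leqP m #|X false :&: A|; have [h4|h4] := leqP m #|X true :&: B|;
    solve [lia | case: (n2 h3 h4)].
- by have [h3|h3] := leqP m #|X false :&: A|; have [h4|h4] := leqP m #|X true :&: B|;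
    solve [lia | case: (n2 h3 h4)].
Qed.

(** Losing up to 8 vertices of a side costs each degree at most 8, so every [big] set is [rich]. *)
Lemma rich_parity (L0 : {set T}) : (forall v, d + 8 <= degin e L0 v) ->
  (forall v, d + 8 <= degin e (~: L0) v) -> odd #|T| -> 2 < #|T| ->
  cycle_space_k e #|T| = cycle_space e.
Proof.
move=> r1 r2 oT T2.
have near_rich M A : (forall v, d + 8 <= degin e M v) -> nearly M A -> rich A.
  move=> rM [s ss MA] v.
  have : [set w in M | e v w] \subset [set w in A | e v w] :|: [set w in s].
    apply/subsetP => w; rewrite !inE => /andP[wM ->]; rewrite andbT.
    by have [//|ws] := boolP (w \in s); rewrite ?orbT // MA.
  move/subset_leq_card => H; have := leq_trans (rM v) H.
  have := leq_of_leqif (leq_card_setU [set w in A | e v w] [set w in s]).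
  have : #|[set w in s]| <= 8 by rewrite cardsE (leq_trans (card_size _)).
  rewrite /degin; lia.
have big_rich A : big L0 A -> rich A by case; apply: near_rich.
apply: (cycle_space_spanned T2) => r r_sym rk.
apply: (@even_labelling_cut T e L0) => //.
- by move=> A x y /big_rich rA xA yA; apply: rich_ham.
- by move=> A B f /big_rich rA /big_rich rB; apply: rich_connected.
- move=> v A /big_rich /(_ v) H.
  have : 0 < degin e A v.
    apply: leq_trans H; rewrite -(ltr_nat R); apply: le_lt_trans d_large.
    by rewrite addr_ge0 // mulr_ge0 // mulr_ge0 // ltW.
  by rewrite card_gt0 => /set0Pn[w]; rewrite inE => /andP[wA evw]; exists w.
Qed.

End Rich.

(** * Random splitting *)

Section Splitting.
Local Open Scope nat_scope.
Variable T : finType.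

(* Exponential moment method: for uniform [f], the mean of the weight 1/2 if
   [f x == c] and 1 otherwise is 3/4. *)
Lemma unbalanced_count (N : {set T}) (k : nat) (c : bool) :
  #|[set f : {ffun T -> bool} | #|[set x in N | f x == c]| < k]| * 4 ^ #|N|
  <= 2 ^ #|T| * 3 ^ #|N| * 2 ^ k.
Proof.
pose F x (b : bool) := if (x \in N) && (b != c) then 2 else 1.
have mass : \sum_(f : {ffun T -> bool}) \prod_x F x (f x) * 2 ^ #|N| = 2 ^ #|T| * 3 ^ #|N|.
  rewrite -big_distrl /= -(bigA_distr_bigA F).
  rewrite (bigID (mem N)) /= (eq_bigr (fun _ => 3)) => [|x xN]; last first.
    by rewrite big_bool /F xN; case: c {F}.
  rewrite [X in _ * X * _](eq_bigr (fun _ => 2)) => [|x /negbTE xN]; last first.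
    by rewrite big_bool /F xN.
  rewrite !prod_nat_const -mulnA -expnD [RHS]mulnC; congr (_ * 2 ^ _).
  by rewrite addnC cardC.
have weight f : \prod_x F x (f x) = 2 ^ #|[set x in N | f x != c]|.
  rewrite -prod_nat_const big_mkcond [RHS]big_mkcond; apply: eq_bigr => x _.
  by rewrite inE /F.
set B := [set f : {ffun T -> bool} | _].
have heavy f : f \in B -> 2 ^ #|N| <= \prod_x F x (f x) * 2 ^ k.
  rewrite inE weight -expnD leq_exp2l // => fk.
  rewrite -(cardsID [set x | f x == c] N) addnC leq_add //.
    by rewrite subset_leq_card //; apply/subsetP => x; rewrite !inE andbC.
  by rewrite ltnW // (leq_ltn_trans _ fk) // subset_leq_card //; apply/subsetP => x; rewrite !inE.
rewrite -mass big_distrl /= (_ : 4 = 2 * 2) // expnMn -sum_nat_const.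
rewrite [leqRHS](bigID (mem B)) /=; apply: leq_trans (leq_addr _ _); apply: leq_sum => f fB.
by rewrite mulnAC leq_mul2r heavy ?orbT.
Qed.

(** Union bound over the 2 n events given by a side and a vertex. *)
Lemma random_split (N : T -> {set T}) (D k : nat) : (forall v, #|N v| = D) ->
  2 * #|T| * 3 ^ D * 2 ^ k < 4 ^ D ->
  exists L : {set T}, forall v, k <= #|N v :&: L| /\ k <= #|N v :&: ~: L|.
Proof.
move=> ND small.
pose B (c : bool) v := [set f : {ffun T -> bool} | #|[set x in N v | f x == c]| < k].
pose Bad := \bigcup_(z : bool * T) B z.1 z.2.
have : #|Bad| < #|{ffun T -> bool}|.
  rewrite card_ffun card_bool -(ltn_pmul2r (_ : 0 < 4 ^ D)) ?expn_gt0 //.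
  apply: (@leq_ltn_trans (\sum_(z : bool * T) #|B z.1 z.2| * 4 ^ D)).
    rewrite -big_distrl leq_mul2r; apply/orP; right.
    rewrite /Bad; elim/big_rec2: _ => [|z n A _ IH]; first by rewrite cards0.
    by apply: leq_trans (leq_of_leqif (leq_card_setU _ _)) _; rewrite leq_add2l.
  apply: (@leq_ltn_trans (\sum_(z : bool * T) 2 ^ #|T| * 3 ^ D * 2 ^ k)).
    by rewrite leq_sum // => -[c v] _; rewrite /= -(ND v) unbalanced_count.
  rewrite sum_nat_const card_prod card_bool.
  rewrite (_ : _ * _ = 2 ^ #|T| * (2 * #|T| * 3 ^ D * 2 ^ k)); last by ring.
  by rewrite ltn_pmul2l ?expn_gt0.
rewrite ltnNge => /negP nb.
have [f fB] : exists f, f \notin Bad.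
  apply/existsP; apply: contra_notT nb; rewrite negb_exists => /forallP H.
  by rewrite subset_leq_card //; apply/subsetP => f _; have := H f; rewrite negbK.
have good c v : k <= #|[set x in N v | f x == c]|.
  rewrite leqNgt; apply: contra fB => H; apply/bigcupP; exists (c, v) => //.
  by rewrite inE.
exists [set x | f x]; move=> v; split.
  have := good true v; congr (_ <= _); apply: eq_card => x; rewrite !inE.
  by case: (f x).
have := good false v; congr (_ <= _); apply: eq_card => x; rewrite !inE.
by case: (f x).
Qed.

End Splitting.

(** Taking fifth powers, it rests on 2 · 3^5 · 2 = 972 <= 1024 = 4^5, where one factor 2 pays for n
    and the other for 2^k. *)
Lemma chernoff_numeric (n D k : nat) : (32 * n ^ 5 < 2 ^ D)%N -> (5 * k <= D)%N ->
  (2 * n * 3 ^ D * 2 ^ k < 4 ^ D)%N.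
Proof.
move=> nD kD; rewrite -(@ltn_exp2r _ _ 5) //.
have H : ((2 ^ k) ^ 5 <= 2 ^ D)%N by rewrite -expnM leq_exp2l // mulnC.
rewrite !expnMn.
apply: (@leq_trans (2 ^ D * (3 ^ D) ^ 5 * 2 ^ D)%N).
  apply: leq_trans (_ : (2 ^ 5 * n ^ 5 * (3 ^ D) ^ 5 * 2 ^ D < _)%N).
    by rewrite ltnS leq_mul2l H orbT.
  by rewrite ltn_pmul2r ?expn_gt0 // ltn_pmul2r ?expn_gt0.
rewrite -!expnM ![(D * 5)%N]mulnC !expnM -!expnMn.
by case: (posnP D) => [->|D0]; rewrite ?expn0 // leq_exp2r.
Qed.

(** * Choice of the parameters *)

Section Asymptotics.
Variable R : realType.
Implicit Types (x y Y eps : R).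

Lemma expR_half_le2 : expR (2^-1 : R) <= 2.
Proof.
have := expR_ge1Dx (- 2^-1 : R); rewrite expRN => H.
have e0 := expR_gt0 (2^-1 : R).
have : (expR (2^-1 : R))^-1 >= 2^-1 by apply: le_trans H; lra.
by rewrite lef_pV2 // posrE.
Qed.

Lemma expR_le_pow2 x (k : nat) : x <= k%:R / 2 -> expR x <= 2 ^+ k.
Proof.
move=> xk; apply: (@le_trans _ _ (expR (k%:R * 2^-1))); first by rewrite ler_expR.
by rewrite expRM_natl lerXn2r ?nnegrE ?expR_ge0 // expR_half_le2.
Qed.

Lemma pow2_le_expR (k : nat) : 2 ^+ k <= expR (k%:R : R).
Proof.
rewrite -[k%:R]mulr1 expRM_natl lerXn2r ?nnegrE ?expR_ge0 //.
by have := expR_ge1Dx (1 : R); lra.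
Qed.

Lemma expR_ge_sqr x : 0 <= x -> x * x / 4 <= expR x.
Proof.
move=> x0; have -> : expR x = expR (x / 2) * expR (x / 2) by rewrite -expRD; congr expR; lra.
have H : x / 2 <= expR (x / 2) by apply: le_trans (expR_ge1Dx _); lra.
have x20 : 0 <= x / 2 by lra.
have -> : x * x / 4 = (x / 2) * (x / 2) by field.
exact: ler_pM.
Qed.

Lemma truncn_bounds x : 0 <= x ->
  exists k : nat, k%:R <= x /\ x < k%:R + 1.
Proof.
by move=> /truncn_itv/andP[h1 h2]; exists (Num.truncn x); rewrite h1 -natr1 in h2 *.
Qed.

(** Here y = log n and Y = loglog n. Up to rounding, m = ε n Y / y, N0 = n / 100, t = 2 y, j = Y /
    20 and q = n / (48000 y). Then 2^t >= e^(t/2) >= n, 48 (2 t + 4) q is at most n / 200, and j q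
    is about n Y / (960000 y), well above 13 m. *)
Lemma parameters eps y Y (n : nat) : eps * 10 ^+ 8 = 1 ->
  n%:R = expR y -> y = expR Y -> 100 <= Y -> 10 ^+ 12 <= y ->
  exists m N0 t j q : nat,
    [/\ (0 < m)%N, eps * n%:R * (Y / y) < m%:R, m%:R <= 2 * eps * n%:R :> R
      & N0%:R <= n%:R / 100 :> R] /\
    [/\ (m <= 2 ^ t)%N, (j <= 3 * (t + 2))%N, (48 * (2 * t + 4) * q <= N0)%N,
        (2 * j + 6 + 13 * m <= j * q)%N & (32 * m * 64 ^ j < N0)%N].
Proof.
move=> epsE ny yY Y100 y12.
have eps0 : 0 < eps by lra.
have y0 : 0 < y by lra.
have Yy : Y <= y by rewrite yY; have := expR_ge1Dx Y; lra.
pose w := n%:R / y.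
have nw : n%:R = w * y by rewrite /w divfK // gt_eqF.
have w0 : y / 4 <= w.
  by rewrite /w ler_pdivlMr // ny; apply: le_trans (expR_ge_sqr (ltW y0)); lra.
have wpos : 0 < w by lra.
have wy1 : w * 100 <= w * y by rewrite ler_pM2l //; lra.
have uE : eps * n%:R * (Y / y) = eps * (w * Y).
  by rewrite nw; field; rewrite gt_eqF.
pose P := w * Y.
have P1 : w * 100 <= P by rewrite ler_pM2l.
have P2 : P <= w * y by rewrite ler_pM2l.
have P3 : 10 ^+ 11 * Y <= P by rewrite /P ler_pM2r //; lra.
have u0 : 0 <= eps * P by rewrite mulr_ge0 //; lra.
have E0 : 10 ^+ 8 != 0 :> R by rewrite expf_neq0 // pnatr_eq0.
have epsV : eps = 1 / 10 ^+ 8 := canRL (mulfK E0) epsE.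
have epsP : eps * P = P / 10 ^+ 8 by rewrite epsV; field.
have epsn : eps * n%:R = n%:R / 10 ^+ 8 by rewrite epsV; field.
have [m' [m1 m2]] := truncn_bounds u0.
have n100 : 0 <= n%:R / 100 :> R by rewrite divr_ge0.
have y2 : 0 <= 2 * y by lra.
have Y20 : 0 <= Y / 20 by lra.
have wA : 0 <= w / (48 * 10 ^+ 3) by lra.
have [N0 [N1 N2]] := truncn_bounds n100.
have [t' [t1 t2]] := truncn_bounds y2.
have [j' [j1 j2]] := truncn_bounds Y20.
have [q [q1 q2]] := truncn_bounds wA.
have mS : (m'.+1)%:R = m'%:R + 1 :> R by rewrite -natr1.
have tS : (t'.+1)%:R = t'%:R + 1 :> R by rewrite -natr1.
have jS : (j'.+1)%:R = j'%:R + 1 :> R by rewrite -natr1.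
have m2n : m'.+1%:R <= 2 * eps * n%:R by rewrite mS -mulrA epsn nw; lra.
exists m'.+1, N0, t'.+1, j'.+1, q; split; split=> //.
- by rewrite uE mS.
- rewrite -(ler_nat R) natrX; apply: (@le_trans _ _ (expR y)).
    by rewrite -ny; apply: le_trans m2n _; rewrite -mulrA epsn nw; lra.
  by apply: expR_le_pow2; rewrite tS; lra.
- by rewrite -(ler_nat R) natrM natrD tS jS; lra.
- rewrite -(ler_nat R) !natrM natrD !natrM tS.
  have q0 : 0 <= q%:R :> R by [].
  have H1 : 48 * (2 * (t'%:R + 1) + 4) <= 48 * (5 * y) by lra.
  have H2 := ler_wpM2r q0 H1.
  have H3 : 48 * (5 * y) * q%:R <= 48 * (5 * y) * (w / (48 * 10 ^+ 3)) by rewrite ler_pM2l //; lra.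
  have H4 : 48 * (5 * y) * (w / (48 * 10 ^+ 3)) = w * y / 200 by field.
  by rewrite nw in N2; lra.
- rewrite -(ler_nat R) !natrD !natrM jS mS.
  have q3 : 0 <= w / (48 * 10 ^+ 3) - 1 by lra.
  have H1 : Y / 20 * (w / (48 * 10 ^+ 3) - 1) <= (j'%:R + 1) * q%:R.
    by apply: ler_pM => //; lra.
  have H2 : Y / 20 * (w / (48 * 10 ^+ 3) - 1) = P / (48 * 10 ^+ 3 * 20) - Y / 20 by rewrite /P; field.
  by lra.
rewrite -(ltr_nat R) !natrM natrX mS.
(* Here g = y^(3/10) bounds 64^j up to a constant, since 64^(Y/20) = 2^(3Y/10), and G = y^(7/10)
   absorbs the factor Y in m. *)
pose g := expR (3 / 10 * Y); pose G := expR (7 / 10 * Y).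
have gG : g * G = y by rewrite /g /G -expRD yY; congr expR; lra.
have g0 : 0 < g by apply: expR_gt0.
have GY : 7 / 10 * Y <= G by apply: le_trans (expR_ge1Dx _); lra.
have pow : 64 ^+ j'.+1 <= (64 * 64) * g.
  have -> : 64 = 2 ^+ 6 :> R by rewrite -natrX.
  rewrite -exprM; apply: le_trans (pow2_le_expR _) _.
  apply: (@le_trans _ _ (expR (6 + 3 / 10 * Y))).
    by rewrite ler_expR natrM jS; lra.
  rewrite expRD ler_pM2r // -exprD.
  by apply: expR_le_pow2; lra.
have m3 : m'%:R + 1 <= 2 * (eps * P) by rewrite epsP in m1 *; lra.
have m30 : 0 <= m'%:R + 1 :> R by rewrite addr_ge0.
have H1 : 32 * (m'%:R + 1) * 64 ^+ j'.+1 <= 32 * (2 * (eps * P)) * (64 * 64 * g).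
  by apply: ler_pM => //; rewrite ?ler_pM2l ?mulr_ge0 ?exprn_ge0.
have H2 : w * g * (7 / 10 * Y) <= w * g * G by rewrite ler_pM2l // mulr_gt0.
have H3 : w * g * G = w * y by rewrite -mulrA gG.
have H4 : 32 * (2 * (eps * P)) * (64 * 64 * g) =
    64 * 64 * 64 * 10 / 7 / (10 ^+ 8) * (w * g * (7 / 10 * Y)).
  by rewrite epsP /P; field.
by rewrite nw in N2; lra.
Qed.

End Asymptotics.

(** * From the minimum degree to a splitting *)

Lemma min_degree_le (T : finType) (e : rel T) (v : T) : (min_degree e <= degree e v)%N.
Proof.
rewrite /min_degree; have : v \in index_enum T by exact: mem_index_enum.
elim: (index_enum T) => [|x s IH] //; rewrite inE big_cons => /orP[/eqP<-|/IH H].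
  exact: geq_minl.
exact: leq_trans (geq_minr _ _) H.
Qed.

Lemma subset_of_card (T : finType) (A : {set T}) (k : nat) : (k <= #|A|)%N ->
  exists2 B : {set T}, B \subset A & #|B| = k.
Proof.
move=> kA; have /card_gt0P[B] : (0 < #|[set B : {set T} | B \subset A & #|B| == k]|)%N.
  by rewrite cards_draws bin_gt0.
by rewrite inE => /andP[BA /eqP kB]; exists B.
Qed.

Lemma rich_split (T : finType) (e : rel T) (D k : nat) : (forall v, D <= degree e v)%N ->
  (32 * #|T| ^ 5 < 2 ^ D)%N -> (5 * k <= D)%N ->
  exists L : {set T}, forall v, (k <= degin e L v)%N /\ (k <= degin e (~: L) v)%N.
Proof.
move=> HD TD kD.
have [N HN] : {N : T -> {set T} & forall v, N v \subset [set w | e v w] /\ #|N v| = D}.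
  apply: (choice (P := fun v (B : {set T}) => B \subset [set w | e v w] /\ #|B| = D)) => v.
  by have [B] := subset_of_card (HD v); exists B.
have [|L HL] := random_split (fun v => (HN v).2) (_ : (2 * #|T| * 3 ^ D * 2 ^ k < 4 ^ D)%N).
  exact: chernoff_numeric.
exists L => v; have [NL NL'] := HL v; have [/subsetP Nv _] := HN v; split.
  apply: leq_trans NL _; apply/subset_leq_card/subsetP => w /setIP[/Nv]; rewrite !inE => -> ->.
  by [].
apply: leq_trans NL' _; apply/subset_leq_card/subsetP => w /setIP[/Nv]; rewrite !inE => -> ->.
by [].
Qed.

Theorem theorem1p3 (R : realType) :
  exists (eps C : R) (n0 : nat),
    [/\ 0 < eps, 1 < C
      & forall n : nat, odd n -> (n0 <= n)%N ->
        forall (T : finType) (e : rel T),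
          symmetric e -> irreflexive e -> #|T| = n ->
        forall p : R,
          C * ln (n%:R : R) / n%:R <= p ->
          (1 - eps) * n%:R * p <= (min_degree e)%:R ->
          (exists beta : R,
             jumbled e p beta /\ beta <= eps * n%:R * p / ln (ln (n%:R : R))) ->
          (forall A B : {set T},
             [disjoint A & B] ->
             eps * n%:R * (ln (ln (n%:R : R)) / ln (n%:R : R)) <= #|A|%:R ->
             eps * n%:R * (ln (ln (n%:R : R)) / ln (n%:R : R)) <= #|B|%:R ->
             exists x y : T, [/\ x \in A, y \in B & e x y]) ->
          cycle_space_k e n = cycle_space e].
Proof.
pose eps : R := (10 ^+ 8)^-1.
have epsE : eps * 10 ^+ 8 = 1 by rewrite /eps mulVf // expf_neq0 // pnatr_eq0.
have [n0 [_ n0E]] := truncn_bounds (expR_ge0 (expR (100 : R))).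
(* With C = 30 the number D below, about n p / 2, satisfies 2^D >= e^(D/2) >= n^6 > 32 n^5, as the
   random splitting demands. The threshold gives loglog n >= 100. *)
exists eps, 30, n0.+1; split; [by rewrite /eps invr_gt0 exprn_gt0|lra|].
move=> n on n0n T e e_sym e_irr Tn p Cp dp [beta [[p0 p1 beta1 jum]] beta_le] iii.
set y : R := ln n%:R in Cp beta_le iii.
set Y : R := ln y in beta_le iii.
have n_big : expR (expR (100 : R)) < n%:R.
  by apply: (lt_le_trans n0E); rewrite natr1 ler_nat.
have npos : 0 < n%:R :> R by apply: lt_trans n_big; exact: expR_gt0.
have ny : n%:R = expR y by rewrite /y lnK.
have y100 : expR (100 : R) < y by move: n_big; rewrite ny ltr_expR.
have ypos : 0 < y by apply: lt_trans y100; exact: expR_gt0.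
have yY : y = expR Y by rewrite /Y lnK.
have Y100 : 100 <= Y by move: y100; rewrite {1}yY ltr_expR => /ltW.
have y12 : 10 ^+ 12 <= y.
  apply: le_trans (ltW y100); apply: le_trans (pow2_le_expR R 100).
  apply: (@le_trans _ _ ((2 ^+ 4) ^+ 12)).
    have h : 10 <= 2 ^+ 4 :> R by lra.
    by rewrite lerXn2r // nnegrE ?exprn_ge0.
  have h : 1 <= 2 :> R by lra.
  by rewrite -exprM; apply: ler_weXn2l.
have [m [N0 [t [j [q [[m0 mu m2 N0n] [Ht Hj HK HC HN]]]]]]] := parameters epsE ny yY Y100 y12.
pose x := n%:R * p.
have x30 : 30 * y <= x.
  by move: Cp; rewrite ler_pdivrMr // /x [n%:R * p]mulrC.
have xpos : 0 < x by lra.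
have x2 : 0 <= x / 2 by lra.
have [D [D1 D2]] := truncn_bounds x2.
have HD v : (D <= degree e v)%N.
  apply: leq_trans (min_degree_le e v); rewrite -(ler_nat R); apply: le_trans dp.
  apply: le_trans D1 _; rewrite -mulrA -/x.
  have : 0 <= (1 / 2 - eps) * x by rewrite mulr_ge0 // ?ltW //; lra.
  lra.
pose k := (D %/ 5)%N.
have kD : (5 * k <= D)%N by rewrite mulnC leq_trunc_div.
have Dk : (D < 5 * k.+1)%N by rewrite mulnC; apply: ltn_ceil.
have Dk' : D%:R + 1 <= 5 * (k%:R + 1) :> R by rewrite !natr1 -natrM ler_nat.
have k8 : (8 <= k)%N by rewrite -(ler_nat R); lra.
pose d := (k - 8)%N.
have dE : d%:R = k%:R - 8 :> R by rewrite /d natrB.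
have TD : (32 * #|T| ^ 5 < 2 ^ D)%N.
  rewrite Tn -(ltr_nat R) natrM !natrX.
  apply: (@lt_le_trans _ _ (expR (6 * y))); last by apply: expR_le_pow2; lra.
  rewrite (expRM_natl 6) -ny [ltRHS]exprS ltr_pM2r ?exprn_gt0 //.
  by rewrite ny; apply: lt_le_trans (expR_ge1Dx _); lra.
have [L HL] := rich_split HD TD kD.
have sparse (U : {set T}) : (edges_in e U)%:R <= p * 'C(#|U|, 2)%:R + beta * #|U|%:R.
  by have := jum U; rewrite ler_norml => /andP[_]; rewrite lerBlDl.
have epsn : eps * n%:R >= 1.
  have : y * y / 4 <= n%:R by rewrite ny; apply: expR_ge_sqr; apply: ltW.
  have : 10 ^+ 12 * y <= y * y by rewrite ler_pM2r.
  move=> h1 h2; rewrite -(ler_pM2r (_ : 0 < 10 ^+ 8 :> R)) ?exprn_gt0 // mulrAC epsE; lra.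
have px : p <= eps * x by rewrite /x mulrA -[leLHS]mul1r ler_pM2r.
have pm : p * m%:R <= 2 * eps * x.
  by rewrite /x mulrA [leRHS]mulrC ler_pM2l.
have eps0 : 0 < eps by rewrite /eps invr_gt0 exprn_gt0.
have betax : beta <= eps * x.
  have enp : eps * n%:R * p = eps * x by rewrite /x mulrA.
  apply: le_trans beta_le _; rewrite enp ler_pdivrMr; last by lra.
  by rewrite ler_peMr ?mulr_ge0 ?ltW //; lra.
have epsx : eps * x = x / 10 ^+ 8 by rewrite /eps mulrC.
have pN0 : p * N0%:R <= x / 100.
  by have := ler_wpM2l (ltW p0) N0n; rewrite /x; lra.
have beta0 : 0 <= beta by lra.
have d_large : 121 * p * m%:R + 22 * beta < d%:R.
  have : 121 * p * m%:R = 121 * (p * m%:R) by rewrite mulrA.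
  lra.
have d_N0 : p * N0%:R + 2 * beta <= d%:R by lra.
have eJ : joined e m.
  move=> A B dis mA mB; apply: iii => //; apply: ltW; apply: lt_le_trans mu _;
  by rewrite ler_nat.
have k8d v : (d + 8 <= degin e L v)%N by rewrite /d subnK //; case: (HL v).
have k8d' v : (d + 8 <= degin e (~: L) v)%N by rewrite /d subnK //; case: (HL v).
rewrite -Tn; apply: (rich_parity e_sym e_irr p0 sparse beta0 d_large d_N0 m0 eJ Ht Hj HK HC HN k8d k8d').
  by rewrite Tn.
by rewrite Tn -(ltr_nat R) ny; apply: lt_le_trans (expR_ge1Dx _); lra.
Qed.
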